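(* Let $\Theta=(\theta_{k,\ell})$ be a real antisymmetric $d\times d$ matrix, $Q=(e^{i\theta_{k,\ell}})$, and let $\eta>\eta_Q$. Suppose that $U$ is a unitary $d$-tuple on a separable Hilbert space that is $\delta$-almost $\Theta$-commuting for some $\delta>0$. Then $U$ is $\varepsilon$-almost gauge invariant for $$\varepsilon=N_\eta\,\delta+\eta .$$
   Context: $U$ is $\delta$-almost $\Theta$-commuting if $\|U_\ell U_k-e^{i\theta_{k,\ell}}U_kU_\ell\|\le\delta$ for all $k,\ell=1,\dots,d$. Let $\mathbb S_Q$ be the subgroup of $\mathbb T^d$ generated by the columns of $Q$, and $\eta_Q=\mathrm d_{\mathrm H}(\mathbb T^d,\mathbb S_Q)$, where $\mathrm d_{\mathrm H}$ is Hausdorff distance with respect to the norm $\|\lambda-\mu\|_\infty=\max_i|\lambda_i-\mu_i|$ on $\mathbb C^d$. For $N\in\mathbb N$, $\mathbb S_Q(N)\subseteq\mathbb S_Q$ is the set of elements given by words of length at most $N$ in the columns of $Q$ and their inverses. For $\eta>\eta_Q$, $N_\eta$ is the least integer with $\mathrm d_{\mathrm H}(\mathbb T^d,\mathbb S_Q(N_\eta))<\eta$. For an operator tuple $A\in B(\mathcal H)^d$, $C^*(A)$ is the unital C*-algebra it generates, and its matrix range has levels $\mathcal W_n(A)=\{\phi(A): \phi\colon C^*(A)\to M_n \text{ unital completely positive}\}$, $n\ge1$ (maps applied entrywise). The matrix range distance is $\mathrm d_{\mathrm{mr}}(A,B)=\sup_n \mathrm d_{\mathrm H}(\mathcal W_n(A),\mathcal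 W_n(B))$, with Hausdorff distance taken with respect to $\|X-Y\|=\max_i\|X_i-Y_i\|$. A unitary tuple $U$ is $\varepsilon$-almost gauge invariant if $\mathrm d_{\mathrm{mr}}(U,U\otimes z)\le\varepsilon$, where $U\otimes z=(U_1\otimes z_1,\dots,U_d\otimes z_d)$ and $z=(z_1,\dots,z_d)$ is the universal commuting unitary tuple (the coordinate functions in $C(\mathbb T^d)$). *)

(* Defs.v *)
From HB Require Import structures.
From mathcomp Require Import all_boot all_order all_algebra.
From mathcomp Require Import sesquilinear complex ring lra.
From mathcomp Require Import all_classical all_reals all_analysis.

Set Implicit Arguments.
Unset Strict Implicit.
Unset Printing Implicit Defensive.

Import Order.TTheory GRing.Theory Num.Theory.
Import numFieldNormedType.Exports.
Local Open Scope classical_set_scope.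
Local Open Scope ring_scope.
Local Open Scope complex_scope.

HB.mixin Record isHilbert (R : realType) H & CompleteNormedModule R[i] H := {
  inner : {dot H for Num.conj};
  innerE : forall u, inner u u = `|u| ^+ 2
}.
#[short(type="hilbertType")]
HB.structure Definition Hilbert (R : realType) :=
  {H of CompleteNormedModule R[i] H & isHilbert R H}.


(* Unital C*-algebras over R[i], possibly trivial. The multiplication is not that
   of a MathComp ring structure: Num.NumDomain already lies below both PzRing and
   NormedZmodule, so no new structure may join these two. *)
HB.mixin Record isCStarAlgebra (R : realType) A
    & CompleteNormedModule R[i] A := {
  cone : A;
  cmul : A -> A -> A;
  star : A -> A;
  cmulA : associative cmul;
  cmul1l : left_id cone cmul;
  cmul1r : right_id cone cmul;
  cmulPl : forall (k : R[i]) (x y z : A),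
    cmul (k *: x + y) z = k *: cmul x z + cmul y z;
  cmulPr : forall (k : R[i]) (x y z : A),
    cmul x (k *: y + z) = k *: cmul x y + cmul x z;
  starK : involutive star;
  starP : forall (k : R[i]) (x y : A),
    star (k *: x + y) = Num.conj k *: star x + star y;
  starM : forall x y : A, star (cmul x y) = cmul (star y) (star x);
  ler_normM : forall x y : A, `|cmul x y| <= `|x| * `|y|;
  cstar_norm : forall x : A, `|cmul (star x) x| = `|x| ^+ 2
}.
#[short(type="cstarAlgType")]
HB.structure Definition CStarAlgebra (R : realType) :=
  {A of CompleteNormedModule R[i] A & isCStarAlgebra R A}.


Section rnorm.
Variable R : realType.

Definition rnorm (V : normedZmodType R[i]) (x : V) : R := complex.Re `|x|.

Variable V : normedZmodType R[i].
Implicit Types x y : V.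

Lemma rnormE x : (rnorm x)%:C = `|x|.
Proof. by rewrite RRe_real// ger0_real. Qed.

Lemma rnorm_ge0 x : 0 <= rnorm x.
Proof. by rewrite -ler0c rnormE. Qed.

Lemma rnorm0 : rnorm (0 : V) = 0.
Proof. by rewrite /rnorm normr0. Qed.

Lemma rnorm0_eq0 x : rnorm x = 0 -> x = 0.
Proof. by move=> x0; apply/normr0_eq0; rewrite -rnormE x0. Qed.

Lemma ler_rnormD x y : rnorm (x + y) <= rnorm x + rnorm y.
Proof. by rewrite -lecR rmorphD/= !rnormE ler_normD. Qed.

Lemma rnormN x : rnorm (- x) = rnorm x.
Proof. by rewrite /rnorm normrN. Qed.

Lemma rdistC x y : rnorm (x - y) = rnorm (y - x).
Proof. by rewrite /rnorm distrC. Qed.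

End rnorm.

Lemma rnorm_le (R : realType) (V W : normedZmodType R[i]) (x : V) (y : W) :
  (rnorm x <= rnorm y) = (`|x| <= `|y|).
Proof. by rewrite -[`|x|]rnormE -[`|y|]rnormE lecR. Qed.

Lemma rnormV (R : realType) (k : R[i]) : rnorm k^-1 = (rnorm k)^-1.
Proof. by apply: complexI; rewrite fmorphV/= !rnormE normfV. Qed.

Lemma rnormM (R : realType) (k l : R[i]) : rnorm (k * l) = rnorm k * rnorm l.
Proof. by apply: complexI; rewrite rmorphM/= !rnormE normrM. Qed.

Section rnormZ.
Variables (R : realType) (V : normedModType R[i]).

Lemma rnormZ (k : R[i]) (x : V) : rnorm (k *: x) = rnorm k * rnorm x.
Proof. by apply: complexI; rewrite rmorphM/= !rnormE normrZ. Qed.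

Lemma rnorm_lim (F : set_system V) (FF : ProperFilter F) (l x : V) (M : R) :
  F --> l -> (\forall y \near F, rnorm (y - x) <= M) -> rnorm (l - x) <= M.
Proof.
move=> Fl FM; apply/ler_addgt0Pl => e e0.
have e0C : 0 < e%:C by rewrite ltcR.
have /cvgrPdist_le/(_ e%:C e0C) Fe : id @ F --> l by [].
have [y [yM ye]] := filter_ex (filterI FM Fe).
rewrite -(subrK y l) -addrA (le_trans (ler_rnormD _ _))// lerD//.
by rewrite -lecR rnormE.
Qed.

End rnormZ.

Section weighted_norm.
Variables (R : realType) (X : Type) (V : normedModType R[i]).
Variable w : X -> R.
Hypothesis w_ge0 : forall x, 0 <= w x.
Implicit Types f g : X -> V.

(* wnorm f is the least M >= 0 with |f x| <= M * w x for all x: the operator norm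
   when w is the norm of the argument, the sup norm when w = 1. *)
Definition wbounds f := [set M : R | 0 <= M /\ forall x, rnorm (f x) <= M * w x].

Definition wbounded f := wbounds f !=set0.

Definition wnorm f : R := inf (wbounds f).

Lemma wbounded0 : wbounded (fun=> 0).
Proof. by exists 0; split => // x; rewrite rnorm0 mul0r. Qed.

Lemma wboundedP k f g : wbounded f -> wbounded g -> wbounded (fun x => k *: f x + g x).
Proof.
move=> [M [M0 fM]] [N [N0 gN]]; exists (rnorm k * M + N); split.
  by rewrite addr_ge0// mulr_ge0// rnorm_ge0.
move=> x; rewrite (le_trans (ler_rnormD _ _))// mulrDl lerD// rnormZ -mulrA.
by rewrite ler_wpM2l// rnorm_ge0.
Qed.

Lemma wnorm_lb f : has_lbound (wbounds f).
Proof. by exists 0 => M []. Qed.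

Lemma wnorm_ge0 f : wbounded f -> 0 <= wnorm f.
Proof. by move=> bf; apply: lb_le_inf => // M []. Qed.

Lemma wnorm_ub f M : 0 <= M -> (forall x, rnorm (f x) <= M * w x) -> wnorm f <= M.
Proof. by move=> M0 fM; apply: ge_inf; [exact: wnorm_lb|split]. Qed.

Lemma le_wnorm f x : wbounded f -> rnorm (f x) <= wnorm f * w x.
Proof.
move=> bf; have [wx0|] := eqVneq (w x) 0.
  by case: bf => M [_ /(_ x)]; rewrite wx0 !mulr0.
move=> wx0; have wx : 0 < w x by rewrite lt_neqAle eq_sym wx0 w_ge0.
rewrite -ler_pdivrMr//; apply: lb_le_inf => // M [M0 fM].
by rewrite ler_pdivrMr.
Qed.

Lemma wnormD f g : wbounded f -> wbounded g ->
  wnorm (fun x => f x + g x) <= wnorm f + wnorm g.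
Proof.
move=> bf bg; apply: wnorm_ub; first by rewrite addr_ge0// wnorm_ge0.
by move=> x; rewrite (le_trans (ler_rnormD _ _))// mulrDl lerD// le_wnorm.
Qed.

Lemma wnormZ_le k f : wbounded f -> wnorm (fun x => k *: f x) <= rnorm k * wnorm f.
Proof.
move=> bf; apply: wnorm_ub; first by rewrite mulr_ge0 ?wnorm_ge0 ?rnorm_ge0.
by move=> x; rewrite rnormZ -mulrA ler_wpM2l ?rnorm_ge0// le_wnorm.
Qed.

Lemma wboundedZ k f : wbounded f -> wbounded (fun x => k *: f x).
Proof.
move=> bf; have := wboundedP k bf wbounded0; congr wbounded.
by apply/funext => x; rewrite addr0.
Qed.

Lemma wnormZ k f : wbounded f -> wnorm (fun x => k *: f x) = rnorm k * wnorm f.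
Proof.
move=> bf; apply/eqP; rewrite eq_le wnormZ_le//=.
have [->|k0] := eqVneq k 0; first by rewrite rnorm0 mul0r wnorm_ge0//; apply: wboundedZ.
have rk0 : 0 < rnorm k.
  by rewrite lt_neqAle rnorm_ge0 andbT eq_sym; apply: contra_neq k0; exact: rnorm0_eq0.
have := @wnormZ_le k^-1 _ (wboundedZ k bf).
rewrite (_ : (fun x => k^-1 *: (k *: f x)) = f); last first.
  by apply/funext => x; rewrite scalerA mulVf// scale1r.
by rewrite rnormV ler_pdivlMl.
Qed.

Lemma wnorm0_eq0 f : wbounded f -> wnorm f = 0 -> f = (fun=> 0).
Proof.
move=> bf f0; apply/funext => x; apply: rnorm0_eq0; apply/le_anti.
by rewrite rnorm_ge0 andbT; have := le_wnorm x bf; rewrite f0 mul0r.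
Qed.

End weighted_norm.

Lemma wcauchy_cvg (R : realType) (X : Type) (V : completeNormedModType R[i])
    (w : X -> R) (T : Type) (F : set_system T) (ev : T -> X -> V) :
  ProperFilter F -> (forall x, 0 <= w x) ->
  (forall e : R, 0 < e -> exists2 A, F A &
     forall s t, A s -> A t -> forall x, rnorm (ev s x - ev t x) <= e * w x) ->
  exists2 f : X -> V, (forall x, ev t x @[t --> F] --> f x) &
  forall e : R, 0 < e -> exists2 A, F A &
     forall t, A t -> forall x, rnorm (f x - ev t x) <= e * w x.
Proof.
move=> FF w0 Fc.
have cv x : cvg (ev t x @[t --> F]).
  apply: cauchy_cvg; apply: cauchy_exP => e e0.
  have := e0; rewrite ltcE/= => /andP[/eqP eIm eRe].
  have [A FA Ae] := Fc (complex.Re e / 2 / (w x + 1)) ltac:(by rewrite !divr_gt0// ltr_wpDl).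
  have [t At] := filter_ex FA; exists (ev t x).
  rewrite nbhs_simpl /=; apply: filterS FA => s As.
  rewrite /= -ball_normE /ball_/=.
  rewrite -rnormE (_ : e = (complex.Re e)%:C); last first.
    by apply/eqP; rewrite eq_complex eqxx/= eIm.
  rewrite ltcR (le_lt_trans (Ae _ _ At As x))// mulrAC.
  rewrite ltr_pdivrMr ?ltr_wpDl//.
  by have := mulr_ge0 (ltW eRe) (w0 x); move: eRe; lra.
exists (fun x => lim (ev t x @[t --> F])) => // e e0.
have [A FA Ae] := Fc e e0; exists A => // t At x.
have FAx : F [set s | rnorm (ev s x - ev t x) <= e * w x].
  by apply: filterS FA => s As /=; exact: (Ae s t As At x).
exact: rnorm_lim (cv x) FAx.
Qed.

Local Notation Re := complex.Re.

Lemma conjcE (R : realType) (x : R[i]) : Num.conj x = conjc x.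
Proof. by []. Qed.

Lemma rnorm_conj (R : realType) (x : R[i]) : rnorm (Num.conj x) = rnorm x.
Proof. by rewrite /rnorm norm_conjC. Qed.

Lemma Re_le_rnorm (R : realType) (x : R[i]) : Re x <= rnorm x.
Proof. by rewrite (le_trans (ler_norm _))// -lecR rnormE normc_ge_Re. Qed.

Lemma mulJ_rnorm (R : realType) (x : R[i]) : Num.conj x * x = (rnorm x ^+ 2)%:C.
Proof. by rewrite rmorphXn/= rnormE normCK mulrC. Qed.

Lemma cReD (R : realType) (x y : R[i]) : Re (x + y) = Re x + Re y.
Proof. by case: x y => a b [c d]. Qed.

Lemma cReN (R : realType) (x : R[i]) : Re (- x) = - Re x.
Proof. by case: x. Qed.

Lemma cReJ (R : realType) (x : R[i]) : Re (Num.conj x) = Re x.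
Proof. by case: x. Qed.

Lemma cReM (R : realType) (r : R) (x : R[i]) : Re (r%:C * x) = r * Re x.
Proof. by case: x => a b /=; rewrite mul0r subr0. Qed.

Lemma rnorm_real (R : realType) (r : R) : 0 <= r -> rnorm r%:C = r.
Proof. by move=> r0; rewrite /rnorm ger0_norm// ler0c. Qed.

Lemma conj_real (R : realType) (r : R) : Num.conj r%:C = r%:C.
Proof. exact: conjc_real. Qed.

Lemma cconjM (R : realType) (x y : R[i]) : Num.conj (x * y) = Num.conj x * Num.conj y.
Proof. exact: rmorphM. Qed.

Lemma cconjN (R : realType) (x : R[i]) : Num.conj (- x) = - Num.conj x.
Proof. exact: rmorphN. Qed.

Section hilbert.
Variables (R : realType) (H : hilbertType R).
Implicit Types u v w : H.

Lemma inner_rnorm u : inner u u = (rnorm u ^+ 2)%:C.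
Proof. by rewrite innerE rmorphXn/= rnormE. Qed.

Lemma inner_conj u v : Num.conj (inner u v) = inner v u.
Proof. by rewrite [inner v u]hermC/= expr0 mul1r. Qed.

Lemma innerPl k u v w : inner (k *: u + v) w = k * inner u w + inner v w.
Proof. by rewrite linearDl/= linearZl_LR. Qed.

Lemma innerPr k u v w : inner w (k *: u + v) = Num.conj k * inner w u + inner w v.
Proof. by rewrite linearD/= linearZr_LR. Qed.

Lemma innerDl u v w : inner (u + v) w = inner u w + inner v w.
Proof. by rewrite linearDl. Qed.

Lemma innerDr u v w : inner w (u + v) = inner w u + inner w v.
Proof. by rewrite linearD. Qed.

Lemma innerBr u v w : inner w (u - v) = inner w u - inner w v.
Proof. by rewrite linearB. Qed.

Lemma innerBl u v w : inner (u - v) w = inner u w - inner v w.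
Proof. by rewrite linearBl. Qed.

Lemma innerZl k u w : inner (k *: u) w = k * inner u w.
Proof. by rewrite linearZl_LR. Qed.

Lemma innerZr k u w : inner w (k *: u) = Num.conj k * inner w u.
Proof. by rewrite linearZr_LR. Qed.

Lemma rnorm2E u : rnorm u ^+ 2 = Re (inner u u).
Proof. by rewrite inner_rnorm. Qed.

Lemma rnorm_sqrD u v :
  rnorm (u + v) ^+ 2 = rnorm u ^+ 2 + rnorm v ^+ 2 + 2 * Re (inner u v).
Proof.
rewrite !rnorm2E !innerDl !innerDr -(inner_conj u v) !cReD cReJ; ring.
Qed.

Lemma rnorm_sqrB u v :
  rnorm (u - v) ^+ 2 = rnorm u ^+ 2 + rnorm v ^+ 2 - 2 * Re (inner u v).
Proof.
rewrite !rnorm2E !innerBl !innerBr -(inner_conj u v) !(cReD,cReN,cReJ); ring.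
Qed.

Lemma CauchySchwarz_inner u v : rnorm (inner u v) <= rnorm u * rnorm v.
Proof.
have [->|v0] := eqVneq v 0; first by rewrite linear0 !rnorm0 mulr0.
have nv : 0 < rnorm v.
  by rewrite lt_neqAle rnorm_ge0 andbT eq_sym; apply: contra_neq v0; exact: rnorm0_eq0.
set c := inner u v.
have := sqr_ge0 (rnorm (u - ((rnorm v ^- 2)%:C * c) *: v)).
have rn : rnorm (rnorm v ^- 2)%:C = rnorm v ^- 2.
  by rewrite rnorm_real// invr_ge0 sqr_ge0.
have iE : inner u (((rnorm v ^- 2)%:C * c) *: v) = (rnorm v ^- 2 * rnorm c ^+ 2)%:C.
  by rewrite innerZr -/c cconjM -mulrA mulJ_rnorm conj_real -rmorphM.
rewrite rnorm_sqrB rnormZ rnormM rn iE [Re _]/=.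
rewrite (_ : _ + _ - _ = rnorm u ^+ 2 - rnorm c ^+ 2 / rnorm v ^+ 2); last first.
  by field; rewrite gt_eqF.
rewrite subr_ge0 ler_pdivrMr ?exprn_gt0// -exprMn.
by rewrite ler_pXn2r// nnegrE ?mulr_ge0 ?rnorm_ge0.
Qed.

Lemma rnorm_sub_conv u v (J : H -> R) (f : H -> R[i]) (I e : R) :
  (forall x y, f (x + y) = f x + f y) ->
  (forall k x, f (k *: x) = k * f x) ->
  (forall x, J x = rnorm x ^+ 2 - 2 * Re (f x)) ->
  (forall x, I <= J x) -> J u <= I + e -> J v <= I + e ->
  rnorm (u - v) ^+ 2 <= 4 * e.
Proof.
move=> fD fZ JE Imin.
have := Imin ((2^-1)%:C *: (u + v)); rewrite !JE.
rewrite rnormZ rnorm_real ?invr_ge0// exprMn fZ fD cReM cReD.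
rewrite rnorm_sqrB rnorm_sqrD; set a := Re (inner u v).
by move=> + + +; lra.
Qed.

Lemma riesz (f : H -> R[i]) (M : R) :
  (forall x y, f (x + y) = f x + f y) ->
  (forall k x, f (k *: x) = k * f x) ->
  (forall x, rnorm (f x) <= M * rnorm x) ->
  exists w, forall v, f v = inner v w.
Proof.
move=> fD fZ fM.
pose J x := rnorm x ^+ 2 - 2 * Re (f x).
have JE x : J x = rnorm x ^+ 2 - 2 * Re (f x) by [].
have Jlb : lbound (range J) (- M ^+ 2).
  move=> _ [x _ <-]; rewrite JE.
  have := le_trans (Re_le_rnorm _) (fM x); have := sqr_ge0 (rnorm x - M).
  by move: (rnorm x) (Re _) => r s; nra.
pose I := inf (range J).
have Imin x : I <= J x by apply: ge_inf; [exists (- M ^+ 2)|exists x].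
pose A (e : R) := [set u | J u <= I + e].
have A0 e : 0 < e -> A e !=set0.
  move=> e0; have [_ [u _ <-] Ju] : exists2 y, range J y & y < I + e.
    apply: inf_adherent => //; split; last by exists (- M ^+ 2).
    by exists (J 0), 0.
  by exists u; exact: ltW.
pose F := filter_from [set e : R | 0 < e] A.
have FF : ProperFilter F.
  apply: filter_from_proper => //; apply: filter_from_filter.
    by exists 1; rewrite /= ltr01.
  move=> i j /= i0 j0; exists (Num.min i j); first by rewrite /= lt_min i0.
  move=> u; rewrite /A /= => Ju.
  by split; rewrite (le_trans Ju)// lerD2l ge_min lexx ?orbT.
have Fc (e : R) : 0 < e -> exists2 B, F B &
    forall s t, B s -> B t -> forall x : unit, rnorm (s - t) <= e * 1.
  move=> e0; exists (A (e ^+ 2 / 4)).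
    by exists (e ^+ 2 / 4) => //=; rewrite divr_gt0// exprn_gt0.
  move=> s t As At _; rewrite mulr1.
  have := rnorm_sub_conv fD fZ JE Imin As At.
  rewrite mulrCA divff// mulr1.
  by rewrite ler_pXn2r// nnegrE ?rnorm_ge0// ltW.
have [w' _ Fw] := @wcauchy_cvg R unit H (fun=> 1) H F (fun u _ => u) FF (fun=> ler01) Fc.
pose w := w' tt.
have small v : rnorm v <= 1 -> f v = inner v w.
  move=> v1; apply/eqP; rewrite -subr_eq0; apply/eqP/rnorm0_eq0/le_anti.
  rewrite rnorm_ge0 andbT; apply/ler_addgt0Pr => e e0; rewrite add0r.
  have e20 : 0 < e / 2 by rewrite divr_gt0.
  have [B FB Bw] := Fw _ e20.
  have FA : F (A ((e / 2) ^+ 2)) by exists ((e / 2) ^+ 2) => //=; rewrite exprn_gt0.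
  have [u [Bu Au]] := filter_ex (filterI FB FA).
  have wu := Bw u Bu tt; rewrite -/w mulr1 in wu.
  pose c := inner v u - f v.
  have cle : rnorm c <= e / 2.
    rewrite -(@ler_pXn2r _ 2)// ?nnegrE ?rnorm_ge0 ?(ltW e20)//.
    have := Imin (u + (- Num.conj c) *: v).
    have := Au; rewrite /A /= !JE fD fZ rnorm_sqrD rnormZ rnormN rnorm_conj innerZr.
    rewrite -(inner_conj v u) cReD.
    have -> : Num.conj (- Num.conj c) * Num.conj (inner v u) =
              - Num.conj (Num.conj c * inner v u).
      by rewrite cconjM cconjN mulNr.
    rewrite cReN cReJ mulNr cReN.
    have : Re (Num.conj c * inner v u) - Re (Num.conj c * f v) = rnorm c ^+ 2.
      by rewrite -cReN -cReD -mulrBr mulJ_rnorm.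
    have : (rnorm c * rnorm v) ^+ 2 <= rnorm c ^+ 2.
      by rewrite exprMn ler_piMr ?sqr_ge0// expr_le1// rnorm_ge0.
    by move=> + + + +; lra.
  rewrite (_ : f v - _ = - c + inner v (u - w)); last first.
    by rewrite innerBr /c opprB addrA subrK.
  rewrite (le_trans (ler_rnormD _ _))// [e]splitr lerD ?rnormN//.
  rewrite (le_trans (CauchySchwarz_inner _ _))// rdistC.
  by rewrite (le_trans _ wu)// ler_piMl ?rnorm_ge0.
exists w => v; pose k := 1 + rnorm v.
have k0 : 0 < k by rewrite ltr_wpDr// rnorm_ge0.
have := small ((k^-1)%:C *: v); rewrite rnormZ rnorm_real ?invr_ge0 ?(ltW k0)//.
rewrite mulrC ler_pdivrMr// mul1r lerDr ler01 fZ innerZl => /(_ isT) kv.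
by apply: (mulfI _ kv); rewrite fmorph_eq0 invr_eq0 gt_eqF.
Qed.

Lemma adjoint_exists (T : H -> H) (M : R) :
  (forall k u v, T (k *: u + v) = k *: T u + T v) ->
  (forall u, rnorm (T u) <= M * rnorm u) ->
  exists S : H -> H, forall u v, inner (T u) v = inner u (S v).
Proof.
move=> TP TM.
have TD u v : T (u + v) = T u + T v by have := TP 1 u v; rewrite !scale1r.
have T0 : T 0 = 0 by have := TD 0 0; rewrite addr0 => /eqP; rewrite eq_sym -subr_eq0 addrK => /eqP.
have TZ k u : T (k *: u) = k *: T u by have := TP k u 0; rewrite T0 !addr0.
suff H1 v : exists w, forall u, inner (T u) v = inner u w.
  by exists (fun v => sval (cid (H1 v))) => u v; case: cid.
apply: (@riesz _ (M * rnorm v)) => [x y|k x|x].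
- by rewrite TD innerDl.
- by rewrite TZ innerZl.
- rewrite (le_trans (CauchySchwarz_inner _ _))// mulrAC.
  by rewrite ler_wpM2r ?rnorm_ge0.
Qed.

Lemma inner_inj u v : (forall w, inner w u = inner w v) -> u = v.
Proof.
move=> uv; apply/eqP; rewrite -subr_eq0; apply/eqP/rnorm0_eq0/eqP.
by rewrite -sqrf_eq0 rnorm2E innerBr uv subrr.
Qed.

End hilbert.

Lemma wcomplete (R : realType) (X : Type) (V : completeNormedModType R[i])
    (w : X -> R) (E : normedModType R[i]) (ev : E -> X -> V) :
  (forall x, 0 <= w x) ->
  (forall s t x, rnorm (ev s x - ev t x) <= rnorm (s - t) * w x) ->
  (forall s t M, 0 <= M -> (forall x, rnorm (ev s x - ev t x) <= M * w x) ->
     rnorm (s - t) <= M) ->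
  (forall (F : set_system E) (f : X -> V), ProperFilter F ->
     (forall x, ev t x @[t --> F] --> f x) ->
     (forall e : R, 0 < e -> exists2 A, F A &
        forall t, A t -> forall x, rnorm (f x - ev t x) <= e * w x) ->
     exists t, ev t = f) ->
  forall F : set_system E, ProperFilter F -> cauchy F -> cvg F.
Proof.
move=> w0 evB leE surj F FF /cauchy_ballP Fc.
have FcR (e : R) : 0 < e -> exists2 A, F A &
    forall s t, A s -> A t -> forall x, rnorm (ev s x - ev t x) <= e * w x.
  move=> e0; have e0C : 0 < e%:C by rewrite ltcR.
  have [[A B] [/= FA FB] AB] := Fc _ e0C.
  exists (A `&` B); first exact: filterI.
  move=> s t [As _] [_ Bt] x; rewrite (le_trans (evB _ _ _))// ler_wpM2r//.
  have := AB (s, t) (conj As Bt).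
  by rewrite /= -ball_normE /ball_/= -rnormE ltcR => /ltW.
have [f cvf Ff] := wcauchy_cvg FF w0 FcR.
have [t tf] := surj F f FF cvf Ff.
apply/cvg_ex; exists t.
suff : id @ F --> t by [].
apply/cvgrPdist_le => e; rewrite ltcE => /andP[/eqP/= eIm eRe].
have [A FA Af] := Ff _ eRe.
apply: filterS FA => s As.
rewrite -rnormE (_ : e = (Re e)%:C); last first.
  by apply/eqP; rewrite eq_complex eqxx/= eIm.
rewrite lecR; apply: leE; first exact: ltW.
by move=> x; rewrite tf; exact: Af.
Qed.

Lemma lincombACA (K : comPzRingType) (V : lmodType K) (k a : K) (x y z t : V) :
  k *: (a *: x + y) + (a *: z + t) = a *: (k *: x + z) + (k *: y + t).
Proof. by rewrite !scalerDr !scalerA [a * k]mulrC addrACA. Qed.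

(* The C*-algebra B(H) of bounded linear operators. *)
Section bop.
Variables (R : realType) (H : hilbertType R).

Definition bop_pred : {pred H -> H} :=
  mem [set T : H -> H | linear T /\ wbounded (fun u => rnorm u) T].

Record bop := Bop { bop_fun :> H -> H; bop_subproof : bop_fun \in bop_pred }.

HB.instance Definition _ := [isSub for bop_fun].
HB.instance Definition _ := [Choice of bop by <:].

Let w0 (u : H) : 0 <= rnorm u. Proof. exact: rnorm_ge0. Qed.

Lemma bop_submod : submod_closed bop_pred.
Proof.
split; first by apply/mem_set; split => [k u v|]; [rewrite /= scaler0 addr0|exact: wbounded0].
move=> k S T; rewrite !inE => -[Sl Sb] [Tl Tb]; split; last exact: wboundedP.
move=> a u v; by rewrite [LHS]/(k *: S (a *: u + v) + T (a *: u + v)) Sl Tl lincombACA.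
Qed.
HB.instance Definition _ := GRing.isSubmodClosed.Build _ _ bop_pred bop_submod.
HB.instance Definition _ := [SubChoice_isSubLmodule of bop by <:].

Implicit Types S T : bop.

Lemma bop_linear T : linear T. Proof. by have /set_mem[] := bop_subproof T. Qed.
Lemma bop_bounded T : wbounded (fun u => rnorm u) T.
Proof. by have /set_mem[] := bop_subproof T. Qed.

Lemma bopP S T : (forall u, S u = T u) -> S = T.
Proof. by move=> ST; apply/val_inj/funext. Qed.

Lemma mk_bop (f : H -> H) : linear f -> wbounded (fun u => rnorm u) f ->
  f \in bop_pred.
Proof. by move=> fl fb; apply/mem_set. Qed.

Lemma bopPE k S T u : (k *: S + T) u = k *: S u + T u. Proof. by []. Qed.
Lemma bopDE S T u : (S + T) u = S u + T u. Proof. by []. Qed.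
Lemma bopBE S T u : (S - T) u = S u - T u. Proof. by []. Qed.
Lemma bopZE k T u : (k *: T) u = k *: T u. Proof. by []. Qed.

Definition opnorm T : R := wnorm (fun u => rnorm u) T.
Let nrm T : R[i] := (opnorm T)%:C.

Lemma bop_normD S T : nrm (S + T) <= nrm S + nrm T.
Proof. by rewrite -rmorphD/= lecR wnormD//; exact: bop_bounded. Qed.
Lemma bop_normZ k T : nrm (k *: T) = `|k| * nrm T.
Proof. by rewrite -rnormE -rmorphM/=; congr (_%:C); apply: wnormZ; last exact: bop_bounded. Qed.
Lemma bop_norm0_eq0 T : nrm T = 0 -> T = 0.
Proof.
move=> [T0]; apply/val_inj; apply: wnorm0_eq0 T0 => //.
exact: bop_bounded.
Qed.

HB.instance Definition _ :=
  @Lmodule_isNormed.Build R[i] bop nrm bop_normD bop_normZ bop_norm0_eq0.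

Lemma bop_rnormE T : rnorm T = opnorm T. Proof. by []. Qed.

Lemma bop_le T u : rnorm (T u) <= rnorm T * rnorm u.
Proof. by rewrite bop_rnormE; apply: le_wnorm => //; exact: bop_bounded. Qed.

Lemma bop_ub T M : 0 <= M -> (forall u, rnorm (T u) <= M * rnorm u) -> rnorm T <= M.
Proof. by move=> M0 TM; rewrite bop_rnormE; exact: wnorm_ub. Qed.

Lemma bop_complete (F : set_system bop) : ProperFilter F -> cauchy F -> cvg F.
Proof.
apply: (@wcomplete R H H (fun u => rnorm u) bop bop_fun) => //.
- by move=> S T u; rewrite -bopBE bop_le.
- by move=> S T M M0 STM; exact: bop_ub.
- move=> {}F f FF cvf Ff.
  have fl : linear f.
    move=> k u v; have c1 := cvf (k *: u + v).
    have c2 : (fun T : bop => k *: T u + T v) @ F --> k *: f u + f v.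
      by apply: cvgD; [apply: cvgZr|]; exact: cvf.
    have e2 : (fun T : bop => k *: T u + T v) = (fun T : bop => T (k *: u + v)).
      by apply/funext => T; rewrite bop_linear.
    rewrite e2 in c2; exact: cvg_unique c1 c2.
  have fb : wbounded (fun u => rnorm u) f.
    have [A FA Af] := Ff 1 ltr01.
    have [T AT] := filter_ex FA.
    exists (1 + rnorm T); split; first by rewrite addr_ge0// rnorm_ge0.
    move=> u; rewrite -[f u](subrK (T u)) mulrDl.
    by rewrite (le_trans (ler_rnormD _ _))// lerD ?bop_le// Af.
  by exists (Bop (mk_bop fl fb)).
Qed.

HB.instance Definition _ := Uniform_isComplete.Build bop bop_complete.

Lemma bop1_proof : idfun \in bop_pred.
Proof. by apply: mk_bop => //; exists 1; split => // u; rewrite mul1r. Qed.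

Definition bop1 := Bop bop1_proof.

Lemma bopM_proof S T : S \o T \in bop_pred.
Proof.
apply: mk_bop; first by move=> k u v /=; rewrite !bop_linear.
exists (rnorm S * rnorm T); split; first by rewrite mulr_ge0 ?rnorm_ge0.
by move=> u; rewrite (le_trans (bop_le S (T u)))// -mulrA ler_wpM2l ?rnorm_ge0 ?bop_le.
Qed.

Definition bopM S T := Bop (bopM_proof S T).

Lemma bop_adjoint T : exists S : bop, forall u v, inner (T u) v = inner u (S v).
Proof.
have [S ST] := adjoint_exists (bop_linear T) (bop_le T).
have Sl : linear S.
  move=> k u v; apply: inner_inj => x.
  by rewrite -ST !innerPr -!ST.
have Sb : wbounded (fun u => rnorm u) S.
  exists (rnorm T); split; first exact: rnorm_ge0.
  move=> v; have [Sv0|Sv0] := eqVneq (rnorm (S v)) 0.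
    by rewrite Sv0 mulr_ge0 ?rnorm_ge0.
  have Sv : 0 < rnorm (S v) by rewrite lt_neqAle eq_sym Sv0 rnorm_ge0.
  rewrite -(ler_pM2l Sv) -expr2 rnorm2E -ST (le_trans (Re_le_rnorm _))//.
  rewrite (le_trans (CauchySchwarz_inner _ _))// mulrA ler_wpM2r ?rnorm_ge0//.
  by rewrite mulrC bop_le.
by exists (Bop (mk_bop Sl Sb)).
Qed.

Definition bop_star T : bop := sval (cid (bop_adjoint T)).

Lemma bop_starE T u v : inner (T u) v = inner u (bop_star T v).
Proof. by rewrite /bop_star; case: cid. Qed.

Lemma bop_starE' T u v : inner (bop_star T u) v = inner u (T v).
Proof. by rewrite -inner_conj -bop_starE inner_conj. Qed.

Lemma bopMA : associative bopM. Proof. by move=> *; exact: bopP. Qed.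
Lemma bopM1l : left_id bop1 bopM. Proof. by move=> *; exact: bopP. Qed.
Lemma bopM1r : right_id bop1 bopM. Proof. by move=> *; exact: bopP. Qed.
Lemma bopMPl k S T (Y : bop) : bopM (k *: S + T) Y = k *: bopM S Y + bopM T Y.
Proof. exact: bopP. Qed.
Lemma bopMPr k (Y : bop) S T : bopM Y (k *: S + T) = k *: bopM Y S + bopM Y T.
Proof. by apply: bopP => u; exact: bop_linear. Qed.

Lemma bop_starK : involutive bop_star.
Proof.
by move=> T; apply: bopP => u; apply: inner_inj => x; rewrite -bop_starE bop_starE'.
Qed.
Lemma bop_starP k S T :
  bop_star (k *: S + T) = Num.conj k *: bop_star S + bop_star T.
Proof.
apply: bopP => u; apply: inner_inj => x.
by rewrite -bop_starE !bopPE innerPl innerPr !bop_starE [Num.conj (Num.conj _)]conjCK.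
Qed.
Lemma bop_starM S T : bop_star (bopM S T) = bopM (bop_star T) (bop_star S).
Proof.
apply: bopP => u; apply: inner_inj => x.
by rewrite -bop_starE /= !bop_starE.
Qed.
Lemma bop_normM S T : `|bopM S T| <= `|S| * `|T|.
Proof.
rewrite -!rnormE -rmorphM/= lecR; apply: bop_ub; first by rewrite mulr_ge0 ?rnorm_ge0.
by move=> u; rewrite (le_trans (bop_le S (T u)))// -mulrA ler_wpM2l ?rnorm_ge0 ?bop_le.
Qed.

Lemma bop_rnorm2 T : rnorm T ^+ 2 <= rnorm (bopM (bop_star T) T).
Proof.
set c := rnorm (bopM _ _); have c0 : 0 <= c by rewrite rnorm_ge0.
rewrite -(sqr_sqrtr c0) ler_pXn2r ?nnegrE ?rnorm_ge0 ?sqrtr_ge0//.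
apply: bop_ub; first exact: sqrtr_ge0.
move=> u; rewrite -(@ler_pXn2r _ 2) ?nnegrE ?mulr_ge0 ?rnorm_ge0 ?sqrtr_ge0//.
rewrite exprMn sqr_sqrtr// rnorm2E bop_starE.
rewrite (le_trans (Re_le_rnorm _))// (le_trans (CauchySchwarz_inner _ _))//.
by rewrite expr2 mulrA mulrC ler_wpM2r ?rnorm_ge0// (bop_le (bopM (bop_star T) T)).
Qed.

Lemma bop_star_le T : rnorm T <= rnorm (bop_star T).
Proof.
have [->|T0] := eqVneq (rnorm T) 0; first exact: rnorm_ge0.
have {}T0 : 0 < rnorm T by rewrite lt_neqAle eq_sym T0 rnorm_ge0.
rewrite -(ler_pM2r T0) -expr2 (le_trans (bop_rnorm2 T))//.
by rewrite -lecR rmorphM/= !rnormE bop_normM.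
Qed.

Lemma bop_cstar_norm T : `|bopM (bop_star T) T| = `|T| ^+ 2.
Proof.
rewrite -!rnormE -rmorphXn/=; congr (_%:C); apply/eqP; rewrite eq_le bop_rnorm2 andbT.
rewrite -lecR rmorphXn/= !rnormE (le_trans (bop_normM _ _))// expr2.
rewrite ler_wpM2r// -!rnormE lecR.
by rewrite -[leRHS]/(rnorm T) -{2}[T]bop_starK bop_star_le.
Qed.

HB.instance Definition _ := isCStarAlgebra.Build R bop
  bopMA bopM1l bopM1r bopMPl bopMPr bop_starK bop_starP bop_starM
  bop_normM bop_cstar_norm.

End bop.

Section cstar_theory.
Variables (R : realType) (A : cstarAlgType R).
Implicit Types x y z : A.

Lemma cmulDl x y z : cmul (x + y) z = cmul x z + cmul y z.
Proof. by have := cmulPl 1 x y z; rewrite !scale1r. Qed.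
Lemma cmulDr x y z : cmul x (y + z) = cmul x y + cmul x z.
Proof. by have := cmulPr 1 x y z; rewrite !scale1r. Qed.
Lemma starD x y : star (x + y) = star x + star y.
Proof. by have := starP 1 x y; rewrite conjC1 !scale1r. Qed.
Lemma cmul0l z : cmul 0 z = 0.
Proof. by apply: (addrI (cmul 0 z)); rewrite -cmulDl !addr0. Qed.
Lemma cmul0r z : cmul z 0 = 0.
Proof. by apply: (addrI (cmul z 0)); rewrite -cmulDr !addr0. Qed.
Lemma star0 : star (0 : A) = 0.
Proof. by apply: (addrI (star 0)); rewrite -starD !addr0. Qed.
Lemma cmulZl k x y : cmul (k *: x) y = k *: cmul x y.
Proof. by have := cmulPl k x 0 y; rewrite cmul0l !addr0. Qed.
Lemma cmulZr k x y : cmul x (k *: y) = k *: cmul x y.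
Proof. by have := cmulPr k x y 0; rewrite cmul0r !addr0. Qed.
Lemma starZ k x : star (k *: x) = Num.conj k *: star x.
Proof. by have := starP k x 0; rewrite star0 !addr0. Qed.
Lemma cmulNl x y : cmul (- x) y = - cmul x y.
Proof. by rewrite -scaleN1r cmulZl scaleN1r. Qed.
Lemma cmulNr x y : cmul x (- y) = - cmul x y.
Proof. by rewrite -scaleN1r cmulZr scaleN1r. Qed.
Lemma starN x : star (- x) = - star x.
Proof. by apply: (addrI (star x)); rewrite -starD !subrr star0. Qed.

Lemma rnorm_cmul x y : rnorm (cmul x y) <= rnorm x * rnorm y.
Proof. by rewrite -lecR rmorphM/= !rnormE ler_normM. Qed.
Lemma rnorm_cstar x : rnorm (cmul (star x) x) = rnorm x ^+ 2.
Proof. by apply: complexI; rewrite rmorphXn/= !rnormE cstar_norm. Qed.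

Lemma rnorm_star x : rnorm (star x) = rnorm x.
Proof.
have le y : rnorm y <= rnorm (star y).
  have [->|y0] := eqVneq (rnorm y) 0; first exact: rnorm_ge0.
  have {}y0 : 0 < rnorm y by rewrite lt_neqAle eq_sym y0 rnorm_ge0.
  by rewrite -(ler_pM2r y0) -expr2 -rnorm_cstar rnorm_cmul.
by apply/le_anti; rewrite le -{2}[x]starK le.
Qed.

Lemma rnorm_continuousP (T : topologicalType) (V : normedModType R[i]) (f : T -> V) (t : T) :
  {for t, continuous f} <->
  forall e : R, 0 < e -> \forall s \near t, rnorm (f s - f t) <= e.
Proof.
split=> [cf e e0|cf].
  have e0C : 0 < e%:C by rewrite ltcR.
  have /cvgrPdist_le/(_ _ e0C) := cf.
  by apply: filterS => s; rewrite -rnormE lecR rdistC.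
apply/cvgrPdist_le => e; rewrite ltcE => /andP[/eqP/= eIm eRe].
apply: filterS (cf _ eRe) => s.
rewrite -rnormE (_ : e = (Re e)%:C) ?lecR 1?rdistC//.
by apply/eqP; rewrite eq_complex eqxx/= eIm.
Qed.

Section cont.
Variables (T : topologicalType) (f g : T -> A) (t : T).
Hypotheses (cf : {for t, continuous f}) (cg : {for t, continuous g}).

Lemma continuous_cmul : {for t, continuous (fun s => cmul (f s) (g s))}.
Proof.
apply/rnorm_continuousP => e e0.
pose m := rnorm (f t) + rnorm (g t) + 1.
have m0 : 0 < m by rewrite ltr_wpDl// addr_ge0 ?rnorm_ge0.
pose d := Num.min 1 (e / m / 2).
have d0 : 0 < d by rewrite lt_min ltr01 !divr_gt0.
have /rnorm_continuousP/(_ _ d0) := cf; have /rnorm_continuousP/(_ _ d0) := cg.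
apply: filterS2 => s gs fs.
rewrite (_ : _ - _ = cmul (f s - f t) (g s - g t) + cmul (f s - f t) (g t) +
   cmul (f t) (g s - g t)); last first.
  rewrite -cmulDr subrK cmulDl cmulDr cmulNl cmulNr.
  by rewrite addrA subrK.
have H1 : rnorm (cmul (f s - f t) (g s - g t)) <= d.
  rewrite (le_trans (rnorm_cmul _ _))// (le_trans (ler_pM _ _ fs gs)) ?rnorm_ge0//.
  by rewrite ler_piMr ?(ltW d0)// ge_min lexx.
have H2 : rnorm (cmul (f s - f t) (g t)) <= d * rnorm (g t).
  by rewrite (le_trans (rnorm_cmul _ _))// ler_wpM2r ?rnorm_ge0.
have H3 : rnorm (cmul (f t) (g s - g t)) <= d * rnorm (f t).
  by rewrite (le_trans (rnorm_cmul _ _))// mulrC ler_wpM2r ?rnorm_ge0.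
rewrite (le_trans (ler_rnormD _ _))// (le_trans (lerD (ler_rnormD _ _) (lexx _)))//.
rewrite (le_trans (lerD (lerD H1 H2) H3))//.
rewrite (_ : _ + _ + _ = d * m); last by rewrite /m; ring.
rewrite -ler_pdivlMr// (le_trans (y := e / m / 2))//; first by rewrite ge_min lexx orbT.
by rewrite ler_piMr ?divr_ge0 ?(ltW e0) ?(ltW m0)// invf_le1// ler1n.
Qed.

Lemma continuous_star : {for t, continuous (fun s => star (f s))}.
Proof.
apply/rnorm_continuousP => e e0.
have /rnorm_continuousP/(_ _ e0) := cf.
by apply: filterS => s; rewrite -starN -starD rnorm_star.
Qed.

End cont.
End cstar_theory.

(* The C*-algebra of bounded continuous functions X -> A with the sup norm. *)
Section cbfun.
Variables (R : realType) (X : topologicalType) (A : cstarAlgType R).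

Definition cbfun_pred : {pred X -> A} :=
  mem [set f : X -> A | continuous f /\ wbounded (fun=> 1) f].

Record cbfun := CBFun { cbfun_fun :> X -> A; cbfun_subproof : cbfun_fun \in cbfun_pred }.

HB.instance Definition _ := [isSub for cbfun_fun].
HB.instance Definition _ := [Choice of cbfun by <:].

Let w0 (x : X) : 0 <= 1 :> R. Proof. exact: ler01. Qed.

Lemma cbfun_submod : submod_closed cbfun_pred.
Proof.
split.
  by apply/mem_set; split => [x|]; [exact: cvg_cst|exact: wbounded0].
move=> k f g; rewrite !inE => -[fc fb] [gc gb]; split; last exact: wboundedP.
by move=> x; apply: cvgD; [apply: cvgZr; exact: fc|exact: gc].
Qed.
HB.instance Definition _ := GRing.isSubmodClosed.Build _ _ cbfun_pred cbfun_submod.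
HB.instance Definition _ := [SubChoice_isSubLmodule of cbfun by <:].

Implicit Types f g : cbfun.

Lemma cbfun_continuous f : continuous f. Proof. by have /set_mem[] := cbfun_subproof f. Qed.
Lemma cbfun_bounded f : wbounded (fun=> 1) f.
Proof. by have /set_mem[] := cbfun_subproof f. Qed.

Lemma cbfunP f g : (forall u, f u = g u) -> f = g.
Proof. by move=> ST; apply/val_inj/funext. Qed.

Lemma mk_cbfun (f : X -> A) (M : R) : continuous f -> 0 <= M ->
  (forall x, rnorm (f x) <= M) -> f \in cbfun_pred.
Proof.
move=> fl M0 fM; apply/mem_set; split => //; exists M; split => // x.
by rewrite mulr1.
Qed.

Lemma cbfunBE f g x : (f - g) x = f x - g x. Proof. by []. Qed.

Definition supnorm f : R := wnorm (fun=> 1) f.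
Let nrm f : R[i] := (supnorm f)%:C.

Lemma cbfun_normD f g : nrm (f + g) <= nrm f + nrm g.
Proof. by rewrite -rmorphD/= lecR wnormD//; exact: cbfun_bounded. Qed.
Lemma cbfun_normZ k f : nrm (k *: f) = `|k| * nrm f.
Proof. by rewrite -rnormE -rmorphM/=; congr (_%:C); apply: wnormZ; last exact: cbfun_bounded. Qed.
Lemma cbfun_norm0_eq0 f : nrm f = 0 -> f = 0.
Proof.
move=> [f0]; apply/val_inj; apply: wnorm0_eq0 f0 => //.
exact: cbfun_bounded.
Qed.

HB.instance Definition _ :=
  @Lmodule_isNormed.Build R[i] cbfun nrm cbfun_normD cbfun_normZ cbfun_norm0_eq0.

Lemma cbfun_rnormE f : rnorm f = supnorm f. Proof. by []. Qed.

Lemma cbfun_le f x : rnorm (f x) <= rnorm f.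
Proof.
rewrite cbfun_rnormE -[leRHS]mulr1.
by apply: (@le_wnorm _ _ _ (fun=> 1)) => //; exact: cbfun_bounded.
Qed.

Lemma cbfun_ub f M : 0 <= M -> (forall u, rnorm (f u) <= M) -> rnorm f <= M.
Proof.
move=> M0 fM; rewrite cbfun_rnormE; apply: wnorm_ub => // x.
by rewrite mulr1.
Qed.

Lemma cbfun_complete (F : set_system cbfun) : ProperFilter F -> cauchy F -> cvg F.
Proof.
apply: (@wcomplete R X A (fun=> 1) cbfun cbfun_fun) => //.
- by move=> f g x; rewrite -cbfunBE mulr1 cbfun_le.
- by move=> f g M M0 fgM; apply: cbfun_ub => // x; rewrite -[M]mulr1; exact: fgM.
- move=> {}F f FF cvf Ff.
  have fc : continuous f.
    move=> x; apply/rnorm_continuousP => e e0.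
    have e30 : 0 < e / 3 by rewrite divr_gt0.
    have [B FB Bf] := Ff _ e30.
    have [g Bg] := filter_ex FB.
    have /rnorm_continuousP/(_ _ e30) := @cbfun_continuous g x.
    apply: filterS => y gyx.
    have := Bf g Bg x; have := Bf g Bg y; rewrite mulr1 => fy fx.
    rewrite (_ : f y - f x = (f y - g y) + (g y - g x) + (g x - f x)); last first.
      by rewrite !subrKA.
    rewrite (le_trans (ler_rnormD _ _))//.
    rewrite (le_trans (lerD (ler_rnormD _ _) (lexx _)))// [rnorm (g x - f x)]rdistC.
    by move: fx fy gyx; lra.
  have [M [M0 fM]] : exists M, 0 <= M /\ forall x, rnorm (f x) <= M.
    have [B FB Bf] := Ff 1 ltr01.
    have [g Bg] := filter_ex FB.
    exists (1 + rnorm g); split; first by rewrite addr_ge0// rnorm_ge0.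
    move=> x; rewrite -[f x](subrK (g x)).
    by rewrite (le_trans (ler_rnormD _ _))// lerD ?cbfun_le// -[leRHS]mulr1 Bf.
  by exists (CBFun (mk_cbfun fc M0 fM)).
Qed.

HB.instance Definition _ := Uniform_isComplete.Build cbfun cbfun_complete.

Lemma cbfun1_proof : (fun=> cone) \in cbfun_pred.
Proof. by apply: (@mk_cbfun _ (rnorm (cone : A))); [move=> x; exact: cvg_cst|exact: rnorm_ge0|]. Qed.

Definition cbfun1 := CBFun cbfun1_proof.

Lemma cbfunM_proof f g : (fun x => cmul (f x) (g x)) \in cbfun_pred.
Proof.
apply: (@mk_cbfun _ (rnorm f * rnorm g)).
- by move=> x; apply: continuous_cmul; exact: cbfun_continuous.
- by rewrite mulr_ge0 ?rnorm_ge0.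
- by move=> x; rewrite (le_trans (rnorm_cmul _ _))// ler_pM ?rnorm_ge0 ?cbfun_le.
Qed.

Definition cbfunM f g := CBFun (cbfunM_proof f g).

Lemma cbfun_star_proof f : (fun x => star (f x)) \in cbfun_pred.
Proof.
apply: (@mk_cbfun _ (rnorm f)); last by move=> x; rewrite rnorm_star cbfun_le.
- by move=> x; apply: continuous_star; exact: cbfun_continuous.
- exact: rnorm_ge0.
Qed.

Definition cbfun_star f := CBFun (cbfun_star_proof f).

Lemma cbfunMA : associative cbfunM.
Proof. by move=> *; apply: cbfunP => x; exact: cmulA. Qed.
Lemma cbfunM1l : left_id cbfun1 cbfunM.
Proof. by move=> *; apply: cbfunP => x; exact: cmul1l. Qed.
Lemma cbfunM1r : right_id cbfun1 cbfunM.
Proof. by move=> *; apply: cbfunP => x; exact: cmul1r. Qed.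
Lemma cbfunMPl k f g (h : cbfun) : cbfunM (k *: f + g) h = k *: cbfunM f h + cbfunM g h.
Proof. by apply: cbfunP => x; exact: cmulPl. Qed.
Lemma cbfunMPr k (h : cbfun) f g : cbfunM h (k *: f + g) = k *: cbfunM h f + cbfunM h g.
Proof. by apply: cbfunP => x; exact: cmulPr. Qed.
Lemma cbfun_starK : involutive cbfun_star.
Proof. by move=> f; apply: cbfunP => x; exact: starK. Qed.
Lemma cbfun_starP k f g :
  cbfun_star (k *: f + g) = Num.conj k *: cbfun_star f + cbfun_star g.
Proof. by apply: cbfunP => x; exact: starP. Qed.
Lemma cbfun_starM f g : cbfun_star (cbfunM f g) = cbfunM (cbfun_star g) (cbfun_star f).
Proof. by apply: cbfunP => x; exact: starM. Qed.
Lemma cbfun_normM f g : `|cbfunM f g| <= `|f| * `|g|.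
Proof.
rewrite -!rnormE -rmorphM/= lecR; apply: cbfun_ub; first by rewrite mulr_ge0 ?rnorm_ge0.
by move=> x; rewrite (le_trans (rnorm_cmul _ _))// ler_pM ?rnorm_ge0 ?cbfun_le.
Qed.
Lemma cbfun_cstar_norm f : `|cbfunM (cbfun_star f) f| = `|f| ^+ 2.
Proof.
rewrite -!rnormE -rmorphXn/=; congr (_%:C); apply/eqP; rewrite eq_le; apply/andP; split.
  apply: cbfun_ub; first exact: sqr_ge0.
  by move=> x; rewrite rnorm_cstar ler_pXn2r ?nnegrE ?rnorm_ge0// cbfun_le.
set c := rnorm (cbfunM _ _ : cbfun); have c0 : 0 <= c by rewrite rnorm_ge0.
rewrite -(sqr_sqrtr c0) ler_pXn2r ?nnegrE ?rnorm_ge0 ?sqrtr_ge0//.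
apply: cbfun_ub; first exact: sqrtr_ge0.
move=> x; rewrite -(@ler_pXn2r _ 2) ?nnegrE ?rnorm_ge0 ?sqrtr_ge0//.
by rewrite sqr_sqrtr// -rnorm_cstar (cbfun_le (cbfunM (cbfun_star f) f)).
Qed.

HB.instance Definition _ := isCStarAlgebra.Build R cbfun
  cbfunMA cbfunM1l cbfunM1r cbfunMPl cbfunMPr cbfun_starK cbfun_starP cbfun_starM
  cbfun_normM cbfun_cstar_norm.

End cbfun.

Section hausdorff.
Variable R : realType.
Local Open Scope ereal_scope.

Definition hausdorff (T : Type) (dist : T -> T -> R) (A B : set T) : \bar R :=
  maxe (ereal_sup [set ereal_inf [set (dist a b)%:E | b in B] | a in A])
       (ereal_sup [set ereal_inf [set (dist a b)%:E | a in A] | b in B]).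

Definition tuple_dist (T : Type) (dist : T -> T -> R) (d : nat) (x y : 'I_d -> T) : R :=
  \big[Num.max/0%R]_(i < d) dist (x i) (y i).

End hausdorff.
Arguments tuple_dist {R T} dist {d} x y.

Section matrix_norm.
Variables (R : realType) (n : nat).

Definition l2norm (v : 'cV[R[i]]_n) : R :=
  Num.sqrt (\sum_(i < n) rnorm (v i ord0) ^+ 2).

Definition mx_opnorm (X : 'M[R[i]]_n) : R :=
  sup [set l2norm (X *m v) | v in [set v | l2norm v <= 1]].

End matrix_norm.

Section matrix_range.
Variables (R : realType) (A : cstarAlgType R).

Definition cstar_subalgebra (B : set A) : Prop :=
  [/\ closed B,
      B cone,
      forall (k : R[i]) x y, B x -> B y -> B (k *: x + y),
      forall x y, B x -> B y -> B (cmul x y) &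
      forall x, B x -> B (star x)].

Definition cstar_gen d (a : 'I_d -> A) : set A :=
  smallest cstar_subalgebra (range a).

(* The k x k block matrix with blocks Z i j in M_n is positive semidefinite; in
   R[i], 0 <= z says that z is real and nonnegative. *)
Definition block_psd n k (Z : 'I_k -> 'I_k -> 'M[R[i]]_n) : Prop :=
  forall v : 'I_k -> 'cV[R[i]]_n,
    0 <= \sum_(i < k) \sum_(j < k)
           ((map_mx Num.conj (v i))^T *m Z i j *m v j) ord0 ord0.

(* Only the restriction of phi to the C*-subalgebra B matters. The positive
   elements of M_k(B) are the products Y^* Y with Y in M_k(B). *)
Definition ucp_on (B : set A) n (phi : A -> 'M[R[i]]_n) : Prop :=
  [/\ forall (k : R[i]) x y, B x -> B y -> phi (k *: x + y) = k *: phi x + phi y,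
      phi cone = 1%:M &
      forall k (Y : 'I_k -> 'I_k -> A), (forall i j, B (Y i j)) ->
        block_psd (fun i j => phi (\sum_(l < k) cmul (star (Y l i)) (Y l j)))].

Definition matrix_range n d (a : 'I_d -> A) : set ('I_d -> 'M[R[i]]_n) :=
  [set (fun i => phi (a i)) | phi in ucp_on (cstar_gen a) (n:=n)].

Definition unitary (x : A) : Prop :=
  cmul (star x) x = cone /\ cmul x (star x) = cone.

End matrix_range.
Arguments matrix_range {R A} n {d} a.
Arguments ucp_on {R A} B n phi.

Definition matrix_range_dist (R : realType) d (A B : cstarAlgType R)
    (a : 'I_d -> A) (b : 'I_d -> B) : \bar R :=
  ereal_sup
    [set hausdorff (tuple_dist (fun X Y : 'M[R[i]]_n => mx_opnorm (X - Y)))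
           (matrix_range n a) (matrix_range n b) | n in [set n | (1 <= n)%N]].

Section torus.
Variables (R : realType) (d : nat).

(* R[i]^o is R[i] with its norm topology. *)
Definition torus : set 'rV[R[i]^o]_d := [set x | forall i, `|x ord0 i| = 1].

Definition max_dist (x y : 'rV[R[i]^o]_d) : R :=
  tuple_dist (fun s t : R[i] => rnorm (s - t)) (x ord0) (y ord0).

Definition torus_one : 'rV[R[i]^o]_d := const_mx 1.
Definition torus_mul (x y : 'rV[R[i]^o]_d) : 'rV[R[i]^o]_d :=
  \row_i (x ord0 i * y ord0 i).
Definition torus_inv (x : 'rV[R[i]^o]_d) : 'rV[R[i]^o]_d :=
  \row_i (x ord0 i)^-1.

Definition torus_subgroup (S : set 'rV[R[i]^o]_d) : Prop :=
  [/\ S `<=` torus,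
      S torus_one,
      forall x y, S x -> S y -> S (torus_mul x y) &
      forall x, S x -> S (torus_inv x)].

Variable Q : 'M[R[i]]_d.

Definition column (l : 'I_d) : 'rV[R[i]^o]_d := (col l Q)^T.

Definition subgroup_SQ : set 'rV[R[i]^o]_d :=
  smallest torus_subgroup (range column).

Definition letter (c : 'I_d * bool) : 'rV[R[i]^o]_d :=
  if c.2 then torus_inv (column c.1) else column c.1.

Definition word_value (w : seq ('I_d * bool)) : 'rV[R[i]^o]_d :=
  foldr (fun c x => torus_mul (letter c) x) torus_one w.

Definition words_SQ (N : nat) : set 'rV[R[i]^o]_d :=
  [set word_value w | w in [set w | (size w <= N)%N]].

Definition eta_of : \bar R := hausdorff max_dist torus subgroup_SQ.

Definition N_of (eta : R) : nat :=
  let good N := (hausdorff max_dist torus (words_SQ N) < eta%:E)%E in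
  xget 0%N [set N | good N /\ forall M, good M -> (N <= M)%N].

End torus.
Arguments torus R d : clear implicits.

Section gauge.
Variables (R : realType) (H : hilbertType R) (d : nat).

Lemma tensor_coord_proof (T : bop H) (i : 'I_d) :
  (fun x : torus R d => (\val x ord0 i : R[i]) *: T) \in @cbfun_pred R (torus R d) (bop H).
Proof.
apply: (@mk_cbfun _ _ _ _ (rnorm T)).
- have c1 : continuous (\val : torus R d -> 'rV[R[i]^o]_d).
    exact: initial_continuous.
  have c2 : continuous (fun x : torus R d => \val x ord0 i).
    have c3 : continuous (fun y : 'rV[R[i]^o]_d => y ord0 i).
      exact: (@coord_continuous R[i]).
    by move=> x; exact: (continuous_comp (c1 x) (c3 (\val x))).
  by move=> x; exact: (cvgZr_tmp (c2 x)).
- exact: rnorm_ge0.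
- move=> x; rewrite rnormZ.
  have /set_mem xi := valP x.
  by rewrite /rnorm xi mul1r.
Qed.

(* B(H) (x) C(T^d) is C(T^d, B(H)), where T (x) z_i is x |-> x_i T; functions in
   cbfun are bounded by definition, which is automatic on the compact T^d. *)
Definition tensor_coord (T : bop H) (i : 'I_d) : cbfun (torus R d) (bop H) :=
  CBFun (tensor_coord_proof T i).

Definition tensor_z (U : 'I_d -> bop H) : 'I_d -> cbfun (torus R d) (bop H) :=
  fun i => tensor_coord (U i) i.

Definition almost_gauge_invariant (e : R) (U : 'I_d -> bop H) : Prop :=
  (matrix_range_dist U (tensor_z U) <= e%:E)%E.

Definition expi (t : R) : R[i] := cos t +i* sin t.

Definition almost_commuting (Theta : 'M[R]_d) (delta : R) (U : 'I_d -> bop H) : Prop :=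
  forall k l : 'I_d,
    rnorm (cmul (U l) (U k) - expi (Theta k l) *: cmul (U k) (U l)) <= delta.

End gauge.

Definition Q_of (R : realType) d (Theta : 'M[R]_d) : 'M[R[i]]_d :=
  map_mx (@expi R) Theta.

Definition separable_space (T : topologicalType) : Prop :=
  exists2 D : set T, countable D & dense D.

(* Main.v *)
Require Import Defs.
From mathcomp Require Import all_boot all_order all_algebra.
From mathcomp Require Import complex.
From mathcomp Require Import all_classical all_reals all_analysis.
From mathcomp Require Import ring lra.

(* Evaluating at 1 in T^d maps U (x) z to U, so W_n(U) is contained in
   W_n(U (x) z). Conversely, let phi be a ucp map on C*(U (x) z). Words W in the
   U_l and their adjoints satisfy W^* U_i W = v_i U_i up to |W| delta, where v is
   the corresponding word in the columns of Q; hence every x in T^d has a unitary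
   W_x with |W_x^* U_i W_x - x_i U_i| <= N delta + eta. The map phi corresponds to
   a positive functional on M_n(C*(U (x) z)), that is, on the quadratic forms
   (x, xi) |-> <Y(x) xi, xi> on T^d x H^n. The M. Riesz extension theorem extends
   it to all quadratically bounded functions of (x, xi), measurable or not, so
   that phi(a)_ij is the "integral" of <a(x) xi_j, xi_i>. No regularity of
   x |-> W_x is then needed to define psi(b)_ij as the integral of
   <b W_x xi_j, W_x xi_i>; this is a ucp map on B(H) with psi(U) close to
   phi(U (x) z). *)

Set Implicit Arguments.
Unset Strict Implicit.
Unset Printing Implicit Defensive.

Import Order.TTheory GRing.Theory Num.Theory.
Import numFieldNormedType.Exports.
Local Open Scope ring_scope.
Local Open Scope classical_set_scope.
Local Open Scope complex_scope.

Local Notation Re := complex.Re.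
Local Notation Im := complex.Im.

(** * The M. Riesz extension theorem *)

(** The unitary W_x runs through finitely many words, so in general it jumps with x, and conjugation
    by it leaves C(T^d, B(H)). This is why [phi] has to be extended before it can be composed with
    that conjugation. The domination condition of the extension theorem dictates the function space:
    |xi|^2 is the form of the unit matrix, so exactly the multiples of it are available as
    majorants. Two gaps remain. Complete positivity gives positivity on products Z^* Z, while the
    extension theorem asks for it on every Y with nonnegative form; square roots in M_n(B) bridge
    this, up to a small multiple of the unit. Moreover the integral is only finitely additive, so
    each estimate must be the integral of a pointwise inequality between quadratic forms. Norm
    bounds are therefore carried in the polarised shape 2 Re <T x, y> <= r (|x|^2 + |y|^2). As [phi]
    is unital, <xi_j, xi_i> integrates to delta_ij, so a pointwise bound e gives the bound e for
    matrices of every size, as the supremum over n demands. *)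

Section riesz_extension.
Variables (R : realType) (V : lmodType R).
Implicit Types (P E : set V) (G : set (V * R)) (x y : V) (r s k : R).

(** Partial functionals are relations, so that extension is inclusion and a chain is bounded by its
    union. Single-valuedness is not imposed: [positive_graph_fun] derives it from positivity. *)
Definition linear_graph G :=
  G (0, 0) /\ forall k x r y s, G (x, r) -> G (y, s) -> G (k *: x + y, k * r + s).

Definition positive_graph P G := forall x r, G (x, r) -> P x -> 0 <= r.

Definition convex_cone P :=
  [/\ P 0, forall x y, P x -> P y -> P (x + y) &
    forall k x, 0 <= k -> P x -> P (k *: x)].

Lemma linear_graphB G x r y s :
  linear_graph G -> G (x, r) -> G (y, s) -> G (x - y, r - s).
Proof.
move=> [_ GP] Gx Gy; have := GP (-1) _ _ _ _ Gy Gx.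
by rewrite scaleN1r mulN1r addrC [- s + r]addrC.
Qed.

Lemma linear_graphZ G k x r : linear_graph G -> G (x, r) -> G (k *: x, k * r).
Proof. by move=> [G0 GP] Gx; have := GP k _ _ _ _ Gx G0; rewrite !addr0. Qed.

Lemma positive_graph_fun P G x r s : P 0 -> linear_graph G -> positive_graph P G ->
  G (x, r) -> G (x, s) -> r = s.
Proof.
move=> P0 lG pG Gr Gs; apply/le_anti.
have := pG _ _ (linear_graphB lG Gr Gs); have := pG _ _ (linear_graphB lG Gs Gr).
by rewrite subrr !subr_ge0 => -> // ->.
Qed.

(** Positivity at x + k y, after division by |k|, only asks that the value at y lie above each r
    with [P (y - x)] and below each r with [P (x - y)], where [G (x, r)]. The two domination
    hypotheses make such a cut possible; its lower end is taken. *)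
Lemma positive_graph_extend P G y : convex_cone P -> linear_graph G ->
  positive_graph P G ->
  (exists x r, G (x, r) /\ P (x - y)) -> (exists x r, G (x, r) /\ P (x + y)) ->
  exists G', [/\ G `<=` G', linear_graph G', positive_graph P G' & exists c, G' (y, c)].
Proof.
move=> [_ PD PZ] lG pG [xu [ru [Gu Pu]]] [xl [rl [Gl Pl]]].
pose L := [set r | exists2 x, G (x, r) & P (y - x)].
have Lub s x : G (x, s) -> P (x - y) -> ubound L s.
  move=> Gx Px r [z Gz Pz].
  rewrite -subr_ge0; apply: pG (linear_graphB lG Gx Gz) _.
  by have := PD _ _ Px Pz; rewrite subrKA.
have L0 : L !=set0.
  exists (- rl); exists (- xl); last by rewrite opprK addrC.
  by have := linear_graphZ (-1) lG Gl; rewrite scaleN1r mulN1r.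
have supL : has_sup L by split=> //; exists ru; exact: Lub Gu Pu.
pose c := sup L.
exists [set p | exists k x r, G (x, r) /\ p = (x + k *: y, r + k * c)]; split.
- move=> [x r] Gx; exists 0, x, r; split=> //.
  by rewrite scale0r mul0r !addr0.
- split; first by exists 0, 0, 0; rewrite scale0r mul0r !addr0; case: lG.
  move=> k _ _ _ _ [a [x [r [Gx [-> ->]]]]] [b [z [s [Gz [-> ->]]]]].
  exists (k * a + b), (k *: x + z), (k * r + s); split; first by case: lG => _; exact.
  congr (_, _); last by ring.
  by rewrite scalerDr scalerA scalerDl addrACA.
- move=> _ _ [k [x [r [Gx [-> ->]]]]] Pk.
  have [k0|k0|k0] := ltgtP k 0; last first.
  + by move: Pk; rewrite k0 scale0r mul0r !addr0; exact: pG.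
  + have : - (r / k) <= c.
      apply: sup_upper_bound => //; exists (- (k^-1 *: x)).
        have := linear_graphZ (- k^-1) lG Gx.
        by rewrite mulNr mulrC scaleNr.
      have ki0 : 0 <= k^-1 by rewrite invr_ge0 ltW.
      have := PZ _ _ ki0 Pk.
      by rewrite scalerDr scalerA mulVf ?gt_eqF// scale1r opprK addrC.
    have rE : r = r / k * k by rewrite divfK ?gt_eqF.
    by move: rE; set t := r / k => -> tc; nra.
  + have : c <= - (r / k).
      apply: ge_sup => //; apply: (@Lub _ (- (k^-1 *: x))).
        have := linear_graphZ (- k^-1) lG Gx.
        by rewrite mulNr mulrC scaleNr.
      have ki0 : 0 <= - k^-1 by rewrite oppr_ge0 invr_le0 ltW.
      have := PZ _ _ ki0 Pk.
      by rewrite scalerDr scalerA mulNr mulVf ?lt_eqF// scaleN1r scaleNr.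
    have rE : r = r / k * k by rewrite divfK ?lt_eqF.
    by move: rE; set t := r / k => -> tc; nra.
- by exists c, 1, 0, 0; rewrite scale1r mul1r !add0r; case: lG.
Qed.

Theorem riesz_extension P E (G0 : set (V * R)) : convex_cone P ->
  linear_graph G0 -> positive_graph P G0 ->
  E 0 -> (forall k x y, E x -> E y -> E (k *: x + y)) ->
  (forall y, E y -> exists x r, G0 (x, r) /\ P (x - y)) ->
  exists f : V -> R,
    [/\ forall k x y, E x -> E y -> f (k *: x + y) = k * f x + f y,
        forall x, E x -> P x -> 0 <= f x &
        forall x r, E x -> G0 (x, r) -> f x = r].
Proof.
move=> cP lG0 pG0 E0 EP Edom.
pose good G := [/\ G0 `<=` G, linear_graph G & positive_graph P G].
have [] := @Zorn_bigcup (V * R) [set G | G = set0 \/ good G].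
  move=> F FG Ftot.
  have [[G FG1 gG]|] := pselect (exists2 G, F G & good G); last first.
    move=> nF; left; rewrite -subset0 => p [G FG1 Gp].
    have [G00|gG] := FG _ FG1; first by rewrite G00 in Gp.
    by case: nF; exists G.
  right; split.
  - by move=> p Gp; exists G => //; case: gG => + _ _; exact.
  - split; first by exists G => //; case: gG => _ [].
    move=> k x r y s [G1 FG1' G1x] [G2 FG2' G2y].
    have lin G3 p : F G3 -> G3 p -> linear_graph G3.
      by move=> /FG[->//|[]].
    have [G12|G21] := Ftot _ _ FG1' FG2'.
      by exists G2 => //; have [_] := lin _ _ FG2' G2y; apply => //; exact: G12.
    by exists G1 => //; have [_] := lin _ _ FG1' G1x; apply => //; exact: G21.
  - by move=> x r [G1 /FG[->//|[_ _ pG1]] G1x]; exact: pG1 G1x.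
move=> G [gG Gmax].
have {}gG : good G.
  case: gG => // G00; have := Gmax G0; rewrite G00 => nG.
  exfalso; apply: nG; last by right; split.
  by split => // G00'; case: lG0 => /G00'.
case: gG => G0G lG pG.
have P0 : P 0 by case: cP.
have Gfun x r s := @positive_graph_fun P G x r s P0 lG pG.
have EN x : E x -> E (- x).
  by move=> Ex; have := EP (-1) _ _ Ex E0; rewrite addr0 scaleN1r.
have Gtot y : E y -> exists r, G (y, r).
  move=> Ey; apply: contrapT => nGy.
  have [x [r [Gx Px]]] := Edom _ Ey.
  (* Dominating -y bounds y from below, which is the other hypothesis of the one-step extension. *)
  have [x' [r' [Gx' Px']]] := Edom _ (EN _ Ey).
  rewrite opprK in Px'.
  have [||G' [GG' lG' pG' [c Gc]]] := @positive_graph_extend P G y cP lG pG.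
  - by exists x, r; split => //; exact: G0G.
  - by exists x', r'; split => //; exact: G0G.
  apply: (Gmax G').
    by split => // /(_ _ Gc) Gyc; apply: nGy; exists c.
  by right; split => // p /G0G /GG'.
pose f y := xget 0 [set r | G (y, r)].
have fG y : E y -> G (y, f y).
  by move=> /Gtot[r Gr]; rewrite /f; case: xgetP => [s _ //|/(_ r)].
exists f; split.
- move=> k x y Ex Ey; apply: (Gfun (k *: x + y)); first exact/fG/EP.
  by case: lG => _; apply; exact: fG.
- by move=> x Ex; apply: pG; exact: fG.
- by move=> x r Ex /G0G Gx; apply: Gfun Gx; exact: fG.
Qed.

End riesz_extension.

(** * Elementary facts on C*-algebras and conjugation by isometries *)

Section cstar_lemmas.
Variables (R : realType) (A : cstarAlgType R).
Implicit Types (a b u v : A).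

Lemma star_cone : star (cone : A) = cone.
Proof. by rewrite -[RHS]starK -[in RHS](cmul1r (star cone)) starM starK cmul1r. Qed.

Lemma star_sum (I : Type) (s : seq I) (F : I -> A) :
  star (\sum_(i <- s) F i) = \sum_(i <- s) star (F i).
Proof. by elim/big_rec2: _ => [|i y1 y2 _ <-]; rewrite ?star0 ?starD. Qed.

Lemma cmul_cvg (F : set_system nat) {FF : Filter F} (f g : nat -> A) (b c : A) :
  f @ F --> b -> g @ F --> c -> cmul (f m) (g m) @[m --> F] --> cmul b c.
Proof.
move=> fb gc.
have h : {for (b, c), continuous (fun s : A * A => cmul s.1 s.2)}.
  by apply: continuous_cmul; [exact: cvg_fst|exact: cvg_snd].
exact: (@continuous2_cvg _ _ _ _ F FF f g (@cmul R A) b c h fb gc).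
Qed.

Lemma star_cvg (F : set_system nat) {FF : Filter F} (f : nat -> A) (b : A) :
  f @ F --> b -> star (f m) @[m --> F] --> star b.
Proof.
move=> fb.
have h : {for b, continuous (fun s : A => star s)} by apply: continuous_star; exact: cvg_id.
exact: (@continuous_cvg _ _ _ F FF f (@star R A) b h fb).
Qed.

(** The C*-identity gives |1| = |1|^2; the value 0 remains possible because the algebra may be
    trivial. *)
Lemma rnorm_cone : rnorm (cone : A) <= 1.
Proof.
have := rnorm_cstar (cone : A); rewrite star_cone cmul1l => h.
have [->|n0] := eqVneq (rnorm (cone : A)) 0; first exact: ler01.
have p0 : 0 < rnorm (cone : A) by rewrite lt_neqAle eq_sym n0 rnorm_ge0.
by rewrite -(ler_pM2l p0) mulr1 -expr2 -h.
Qed.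

Lemma rnorm_isometry u : cmul (star u) u = cone -> rnorm u <= 1.
Proof.
move=> uu; rewrite -(@ler_pXn2r _ 2) ?nnegrE ?rnorm_ge0// expr1n.
by rewrite -rnorm_cstar uu rnorm_cone.
Qed.

Definition conjugate u a : A := cmul (star u) (cmul a u).

Lemma conjugateP u k a b : conjugate u (k *: a + b) = k *: conjugate u a + conjugate u b.
Proof. by rewrite /conjugate cmulPl cmulPr. Qed.

Lemma conjugateM u v a : conjugate (cmul u v) a = conjugate v (conjugate u a).
Proof. by rewrite /conjugate starM !cmulA. Qed.

Lemma rnorm_conjugate u a : cmul (star u) u = cone -> rnorm (conjugate u a) <= rnorm a.
Proof.
move=> /rnorm_isometry u1; rewrite (le_trans (rnorm_cmul _ _))// rnorm_star.
have := rnorm_cmul a u; move: (rnorm_ge0 a) (rnorm_ge0 u) (rnorm_ge0 (cmul a u)) u1.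
by move: (rnorm a) (rnorm u) (rnorm _) => p q r; nra.
Qed.

Variable B : set A.
Hypothesis subB : cstar_subalgebra B.

Lemma subalg0 : B 0.
Proof.
case: subB => _ B1 BP _ _.
by have := BP (-1) _ _ B1 B1; rewrite scaleN1r addNr.
Qed.

Lemma subalg_sum (I : Type) (s : seq I) (F : I -> A) :
  (forall i, B (F i)) -> B (\sum_(i <- s) F i).
Proof.
move=> BF; case: subB => _ B1 BP _ _.
elim/big_ind: _ => [||//]; [exact: subalg0|move=> x y Bx By].
by have := BP 1 _ _ Bx By; rewrite scale1r.
Qed.

Lemma subalgZ k (x : A) : B x -> B (k *: x).
Proof.
have B0 := subalg0; case: subB => _ _ BP _ _ Bx.
by have := BP k _ _ Bx B0; rewrite addr0.
Qed.

Lemma subalgP k (x y : A) : B x -> B y -> B (k *: x + y).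
Proof. by case: subB => _ _ + _ _; exact. Qed.

End cstar_lemmas.

(** * Operators on H^n and matrices over a C*-algebra of operators *)

Section tuple_inner.
Variables (R : realType) (H : hilbertType R) (n : nat).
Implicit Types (x y z : 'I_n -> H) (T : ('I_n -> H) -> 'I_n -> H) (r : R).

Definition vip x y : R[i] := \sum_i inner (x i) (y i).
Definition vnsq x : R := \sum_i rnorm (x i) ^+ 2.

Lemma vnsqE x : vip x x = (vnsq x)%:C.
Proof. by rewrite rmorph_sum; apply: eq_bigr => i _; rewrite inner_rnorm. Qed.

Lemma vnsq_ge0 x : 0 <= vnsq x.
Proof. by apply: sumr_ge0 => i _; exact: sqr_ge0. Qed.

Lemma vip_conj x y : Num.conj (vip x y) = vip y x.
Proof. by rewrite rmorph_sum; apply: eq_bigr => i _; exact: inner_conj. Qed.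

Lemma vipDl x y z : vip (x + y) z = vip x z + vip y z.
Proof. by rewrite -big_split; apply: eq_bigr => i _; exact: innerDl. Qed.

Lemma vipZl k x z : vip (k *: x) z = k * vip x z.
Proof. by rewrite mulr_sumr; apply: eq_bigr => i _; exact: innerZl. Qed.

Lemma vipDr x y z : vip x (y + z) = vip x y + vip x z.
Proof. by rewrite -vip_conj vipDl rmorphD/= !vip_conj. Qed.

Lemma vipZr k x z : vip x (k *: z) = Num.conj k * vip x z.
Proof. by rewrite -vip_conj vipZl cconjM vip_conj. Qed.

Lemma Re_vipC x y : Re (vip x y) = Re (vip y x).
Proof. by rewrite -[in RHS]vip_conj cReJ. Qed.

Lemma vnsqD x (s : R) y :
  vnsq (x + s%:C *: y) = vnsq x + 2 * s * Re (vip x y) + s ^+ 2 * vnsq y.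
Proof.
have E z : vnsq z = Re (vip z z) by rewrite vnsqE.
rewrite !E !vipDl !vipDr !vipZl !vipZr !conj_real !cReD !cReM (Re_vipC y x).
by ring.
Qed.

(** For r > 0 this says exactly that |T x| <= r |x| for all x, by [opb_contr] and [contr_opb]. In
    this form the bound passes to sums of operators without a triangle inequality on H^n. *)
Definition opb r T := forall x y, 2 * Re (vip (T x) y) <= r * (vnsq x + vnsq y).

Lemma vnsqZ (s : R) x : vnsq (s%:C *: x) = s ^+ 2 * vnsq x.
Proof.
rewrite mulr_sumr; apply: eq_bigr => i _.
rewrite -exprMn; have [s0|s0] := lerP 0 s.
  by congr (_ ^+ 2); rewrite rnormZ rnorm_real.
rewrite -[RHS]sqrrN -mulNr; congr (_ ^+ 2).
rewrite -[s]opprK rmorphN scaleNr rnormN rnormZ rnorm_real ?opprK//.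
by rewrite oppr_ge0 ltW.
Qed.

Lemma opb_contr r T x : 0 < r -> opb r T -> vnsq (T x) <= r ^+ 2 * vnsq x.
Proof.
(* The test vector y = T x / r makes the left side 2 |T x|^2 / r, half of which absorbs the term in
   |y|^2. *)
move=> r0 /(_ x ((r^-1)%:C *: T x)).
rewrite vipZr conj_real cReM vnsqZ.
have -> : Re (vip (T x) (T x)) = vnsq (T x) by rewrite vnsqE.
move: (vnsq (T x)) (vnsq x) => N M h.
have := ler_wpM2l (ltW r0) h.
have -> : r * (2 * (r^-1 * N)) = 2 * N by field; rewrite gt_eqF.
have -> : r * (r * (M + r^-1 ^+ 2 * N)) = r ^+ 2 * M + N by field; rewrite gt_eqF.
by lra.
Qed.

Lemma contr_opb r T : 0 < r -> (forall x, vnsq (T x) <= r ^+ 2 * vnsq x) -> opb r T.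
Proof.
move=> r0 Tr x y.
(* Expand |T x - r y|^2 >= 0. *)
have := vnsq_ge0 (T x + (- r)%:C *: y); rewrite vnsqD => h.
have {}h : 2 * r * Re (vip (T x) y) <= r * (r * (vnsq x + vnsq y)).
  by have := Tr x; move: h; rewrite sqrrN; nra.
by rewrite -(ler_pM2l r0) mulrCA mulrA.
Qed.

(** Positivity of T at x - T x / r reads 2 |T x|^2 / r <= <T x, x> + <T T x, T x> / r^2, and the
    upper bound on the form estimates both terms on the right. *)
Lemma psd_contr r T x : 0 < r ->
  (forall k y z, T (k *: y + z) = k *: T y + T z) ->
  (forall y z, vip (T y) z = vip y (T z)) ->
  (forall y, 0 <= Re (vip (T y) y) <= r * vnsq y) ->
  vnsq (T x) <= r ^+ 2 * vnsq x.
Proof.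
move=> r0 TP Tsym Tr.
have /andP[+ _] := Tr ((- r^-1)%:C *: T x + x).
have /andP[_ h1] := Tr (T x); have /andP[_ h2] := Tr x.
rewrite TP !vipDl !vipDr !vipZl !vipZr conj_real !cReD !cReM.
rewrite (Tsym (T x) x).
have -> : Re (vip (T x) (T x)) = vnsq (T x) by rewrite vnsqE.
move: h1 h2; move: (Re _) (Re _) (vnsq (T x)) (vnsq x) => a b N M h1 h2 h.
have := ler_wpM2l (ltW r0) h.
rewrite mulr0 !mulrDr.
have -> : r * (- r^-1 * (- r^-1 * b)) = r^-1 * b by field; rewrite gt_eqF.
have -> : r * (- r^-1 * N) = - N by field; rewrite gt_eqF.
have : r^-1 * b <= N by rewrite ler_pdivrMl.
by nra.
Qed.

End tuple_inner.

Section matrix_action.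
Variables (R : realType) (X : topologicalType) (H : hilbertType R) (n : nat).
Local Notation A := (cbfun X (bop H)).
Local Notation mat := ('I_n -> 'I_n -> A).
Implicit Types (Y Z : mat) (x : X) (u v : 'I_n -> H).

Definition mact Y x u : 'I_n -> H := fun i => \sum_j Y i j x (u j).
Definition mmul Y Z : mat := fun i j => \sum_k cmul (Y i k) (Z k j).
Definition madj Y : mat := fun i j => star (Y j i).
Definition mone : mat := fun i j => if i == j then cone else 0.

Lemma cbfun_sum (I : Type) (s : seq I) (F : I -> A) x :
  (\sum_(i <- s) F i) x = \sum_(i <- s) F i x.
Proof. by elim/big_rec2: _ => // i y1 y2 _ <-. Qed.

Lemma bop_sum (I : Type) (s : seq I) (F : I -> bop H) (h : H) :
  (\sum_(i <- s) F i) h = \sum_(i <- s) F i h.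
Proof. by elim/big_rec2: _ => // i y1 y2 _ <-. Qed.

Lemma bop0 (T : bop H) : T 0 = 0.
Proof. by have := bop_linear T (-1) 0 0; rewrite scaler0 addr0 scaleN1r addNr. Qed.

Lemma bopD (T : bop H) (h h' : H) : T (h + h') = T h + T h'.
Proof. by have := bop_linear T 1 h h'; rewrite !scale1r. Qed.

Lemma bopZ (T : bop H) k (h : H) : T (k *: h) = k *: T h.
Proof. by have := bop_linear T k h 0; rewrite bop0 !addr0. Qed.

Lemma bop_sumr (T : bop H) (I : Type) (s : seq I) (F : I -> H) :
  T (\sum_(i <- s) F i) = \sum_(i <- s) T (F i).
Proof. by elim/big_rec2: _ => [|i y1 y2 _ <-]; rewrite ?bop0 ?bopD. Qed.

Lemma inner0l (h : H) : inner 0 h = 0.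
Proof. by rewrite -(scale0r (0 : H)) innerZl mul0r. Qed.

Lemma inner_suml (I : Type) (s : seq I) (F : I -> H) (h : H) :
  inner (\sum_(i <- s) F i) h = \sum_(i <- s) inner (F i) h.
Proof.
elim/big_rec2: _ => [|i y1 y2 _ <-]; last exact: innerDl.
exact: inner0l.
Qed.

Lemma inner_sumr (I : Type) (s : seq I) (F : I -> H) (h : H) :
  inner h (\sum_(i <- s) F i) = \sum_(i <- s) inner h (F i).
Proof.
by rewrite -inner_conj inner_suml rmorph_sum; apply: eq_bigr => i _; exact: inner_conj.
Qed.

Lemma mact_linear Y x k u v : mact Y x (k *: u + v) = k *: mact Y x u + mact Y x v.
Proof.
apply/funext => i.
rewrite [RHS](_ : _ = k *: (\sum_j Y i j x (u j)) + \sum_j Y i j x (v j))//.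
by rewrite scaler_sumr -big_split; apply: eq_bigr => j _; exact: bop_linear.
Qed.

Lemma mactM Y Z x u : mact (mmul Y Z) x u = mact Y x (mact Z x u).
Proof.
apply/funext => i; rewrite /mact/=.
under [RHS]eq_bigr do rewrite bop_sumr.
rewrite exchange_big/=; apply: eq_bigr => j _.
by rewrite /mmul cbfun_sum bop_sum.
Qed.

Lemma mact_adj Y x u v : vip (mact (madj Y) x u) v = vip u (mact Y x v).
Proof.
rewrite /vip /mact.
under eq_bigr do rewrite inner_suml.
under [RHS]eq_bigr do rewrite inner_sumr.
rewrite exchange_big/=; apply: eq_bigr => j _; apply: eq_bigr => i _.
exact: bop_starE'.
Qed.

Lemma mact1 x u : mact mone x u = u.
Proof.
apply/funext => i; rewrite /mact (bigD1 i)//= /mone eqxx big1 ?addr0// => j.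
by rewrite eq_sym => /negbTE ->.
Qed.

Lemma mmul1l Y i j : mmul mone Y i j = Y i j.
Proof.
rewrite /mmul (bigD1 i)//= big1 ?addr0; first by rewrite /mone eqxx cmul1l.
by move=> k ki; rewrite /mone eq_sym (negbTE ki) cmul0l.
Qed.

Lemma mmul1r Y i j : mmul Y mone i j = Y i j.
Proof.
rewrite /mmul (bigD1 j)//= big1 ?addr0; first by rewrite /mone eqxx cmul1r.
by move=> k ki; rewrite /mone (negbTE ki) cmul0r.
Qed.

Lemma star_mone i j : star ((mone : mat) i j) = mone j i.
Proof. by rewrite /mone eq_sym; case: ifP => _; [exact: star_cone|exact: star0]. Qed.

Lemma mactP k Y Z x u :
  mact (fun i j => k *: Y i j + Z i j) x u = k *: mact Y x u + mact Z x u.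
Proof.
apply/funext => i.
rewrite [RHS](_ : _ = k *: (\sum_j Y i j x (u j)) + \sum_j Z i j x (u j))//.
by rewrite scaler_sumr -big_split.
Qed.

(** The square root iteration is estimated as operators on H^n but converges entry by entry in the
    algebra. A vector supported in the coordinate j isolates one column. *)
Lemma opb_entry r Y i j : 0 < r -> (forall x, opb r (mact Y x)) -> rnorm (Y i j) <= r.
Proof.
move=> r0 Yr; apply: cbfun_ub => [|x]; first exact: ltW.
apply: bop_ub => [|h]; first exact: ltW.
pose u k := if k == j then h else 0.
have := opb_contr u r0 (Yr x).
have -> : vnsq u = rnorm h ^+ 2.
  rewrite /vnsq (bigD1 j)//= /u eqxx big1 ?addr0// => k /negbTE ->.
  by rewrite rnorm0 expr0n.
have : rnorm (Y i j x h) ^+ 2 <= vnsq (mact Y x u).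
  rewrite [leRHS](bigD1 i)//= /mact (bigD1 j)//= big1 ?addr0; last first.
    by move=> k /negbTE kj; rewrite /u kj bop0.
  by rewrite /u eqxx lerDl sumr_ge0// => k _; exact: sqr_ge0.
move=> /le_trans h1 /h1; rewrite -exprMn ler_pXn2r// nnegrE ?rnorm_ge0//.
by rewrite mulr_ge0 ?rnorm_ge0// ltW.
Qed.

End matrix_action.
Arguments mone {R X H n} i j.

(** * Square roots in M_n(B) *)

Lemma geometric_cvg (R : realType) (V : completeNormedModType R[i]) (r : R) (v : nat -> V) :
  0 < r < 1 -> (forall m, rnorm (v m.+1 - v m) <= r ^+ m.+1) ->
  exists l : V, v m @[m --> \oo] --> l.
Proof.
move=> /andP[r0 r1] vr.
have s0 : 0 < 1 - r by rewrite subr_gt0.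
(* Telescoping. The exact geometric sum has a further factor r, which is dropped. *)
have vN N k : rnorm (v (N + k)%N - v N) <= (r ^+ N - r ^+ (N + k)) / (1 - r).
  elim: k => [|k IH]; first by rewrite addn0 !subrr rnorm0 mul0r.
  rewrite addnS -(subrKA (v (N + k)%N)) (le_trans (ler_rnormD _ _))//.
  rewrite (le_trans (lerD (vr _) IH))// ler_pdivlMr// mulrDl divfK ?gt_eqF//.
  have := mulr_ge0 (ltW (exprn_gt0 (N + k) r0)) (sqr_ge0 (1 - r)).
  by rewrite !exprS; move: (r ^+ (N + k)) (r ^+ N) => p q; nra.
have [] := @wcauchy_cvg R unit V (fun=> 1) nat \oo (fun m _ => v m) _ (fun=> ler01).
  move=> e e0.
  have e1 : 0 < e / 2 * (1 - r) by rewrite mulr_gt0// divr_gt0.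
  have : (GRing.exp r) @ \oo --> (0 : R) by apply: cvg_expr; rewrite gtr0_norm.
  move=> /cvgrPdist_le/(_ _ e1)[N _ HN].
  exists [set m | (N <= m)%N]; first exact: nbhs_infty_ge.
  have close s : (N <= s)%N -> rnorm (v s - v N) <= e / 2.
    move=> /subnKC <-; apply: le_trans (vN _ _) _.
    rewrite ler_pdivrMr//; have := HN N (leqnn _).
    rewrite /= sub0r normrN ger0_norm ?exprn_ge0 ?(ltW r0)// => h; apply: le_trans h.
    by rewrite lerBlDr lerDl exprn_ge0// ltW.
  move=> s t /= /close hs /close ht _; rewrite mulr1 -(subrKA (v N)).
  rewrite (le_trans (ler_rnormD _ _))// [rnorm (v N - _)]rdistC.
  by rewrite [e]splitr lerD.
by move=> f cf _; exists (f tt).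
Qed.

Section opb_theory.
Variables (R : realType) (H : hilbertType R) (n : nat).
Implicit Types (S T : ('I_n -> H) -> 'I_n -> H) (r s : R).

Lemma opbW r s T : r <= s -> opb r T -> opb s T.
Proof.
move=> rs Tr x y; apply: le_trans (Tr x y) _.
by rewrite ler_wpM2r// addr_ge0 ?vnsq_ge0.
Qed.

Lemma opbD r s S T : opb r S -> opb s T -> opb (r + s) (fun u => S u + T u).
Proof.
by move=> Sr Ts x y; rewrite vipDl cReD mulrDr [leRHS]mulrDl; apply: lerD.
Qed.

Lemma opbZ (k r : R) T : 0 <= k -> opb r T -> opb (k * r) (fun u => k%:C *: T u).
Proof.
move=> k0 Tr x y; rewrite vipZl cReM mulrCA -[leRHS]mulrA; exact: ler_wpM2l.
Qed.

Lemma opb_comp r s S T : 0 < r -> 0 < s -> opb r S -> opb s T -> opb (r * s) (S \o T).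
Proof.
move=> r0 s0 Sr Ts; apply: contr_opb => [|x]; first exact: mulr_gt0.
apply: le_trans (opb_contr _ r0 Sr) _.
rewrite exprMn -[leRHS]mulrA; apply: ler_wpM2l (opb_contr _ s0 Ts); exact: sqr_ge0.
Qed.

End opb_theory.

Section msqrt.
Variables (R : realType) (X : topologicalType) (H : hilbertType R) (n : nat).
Local Notation A := (cbfun X (bop H)).
Local Notation mat := ('I_n -> 'I_n -> A).
Variable B : set A.
Hypothesis subB : cstar_subalgebra B.

Variables (a : mat) (r : R).
Hypotheses (r01 : 0 < r < 1) (Ba : forall i j, B (a i j)).
Hypothesis a_sym : forall i j, star (a i j) = a j i.
Hypothesis ar : forall x, opb r (mact a x).

(* Iterates towards 1 - sqrt (1 - a), the small solution of 2 y = a + y^2. *)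
Fixpoint sqrt_iter (m : nat) : mat :=
  if m is m'.+1 then
    fun i j => (2^-1)%:C *: (a i j + mmul (sqrt_iter m') (sqrt_iter m') i j)
  else fun _ _ => 0.

Let r0 : 0 < r. Proof. by case/andP: r01. Qed.

Lemma sqrt_iter_sub m i j : B (sqrt_iter m i j).
Proof.
have B0 := subalg0 subB; have [_ B1 BP BM _] := subB.
elim: m i j => [//|m IH] i j /=.
have Bs : B (mmul (sqrt_iter m) (sqrt_iter m) i j).
  by apply: (subalg_sum subB) => k; exact: BM.
have := BP 1 _ _ (Ba i j) Bs; rewrite scale1r => Bs'.
by have := BP (2^-1)%:C _ _ Bs' B0; rewrite addr0.
Qed.

Lemma sqrt_iter_sym m i j : star (sqrt_iter m i j) = sqrt_iter m j i.
Proof.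
elim: m i j => [|m IH] i j /=; first exact: star0.
rewrite starZ conj_real starD a_sym star_sum; congr (_ *: (_ + _)).
by apply: eq_bigr => k _; rewrite starM !IH.
Qed.

Lemma mact_sqrt_iter m x u : mact (sqrt_iter m.+1) x u =
  (2^-1)%:C *: (mact a x u + mact (sqrt_iter m) x (mact (sqrt_iter m) x u)).
Proof.
rewrite -mactM -[mact a x u]scale1r -mactP.
apply/funext => i; rewrite [RHS]scaler_sumr; apply: eq_bigr => j _ /=.
by rewrite scale1r.
Qed.

Lemma mact0 x u : mact (sqrt_iter 0) x u = 0.
Proof. by apply/funext => i; rewrite /mact/= big1. Qed.

Lemma sqrt_iter_opb m x : opb r (mact (sqrt_iter m) x).
Proof.
elim: m => [|m IH].
  move=> u v; rewrite mact0 -(scale0r (0 : 'I_n -> H)) vipZl mul0r mulr0.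
  by rewrite mulr_ge0 ?(ltW r0)// addr_ge0 ?vnsq_ge0.
have h : opb (2^-1 * (r + r * r)) (mact (sqrt_iter m.+1) x).
  have -> : mact (sqrt_iter m.+1) x = fun u =>
      (2^-1)%:C *: (mact a x u + mact (sqrt_iter m) x (mact (sqrt_iter m) x u)).
    by apply/funext => u; exact: mact_sqrt_iter.
  by apply: opbZ; [rewrite invr_ge0|apply: opbD; [exact: ar|exact: opb_comp]].
(* The bound reproduces itself because (r + r^2) / 2 <= r for r < 1. *)
by apply: opbW h; case/andP: r01 => *; nra.
Qed.

Let D m : mat := fun i j => (-1) *: sqrt_iter m i j + sqrt_iter m.+1 i j.

(** With d = y_{m+1} - y_m, twice the next difference is y_{m+1}^2 - y_m^2 = y_{m+1} d + d y_m, a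
    splitting that asks for no commutation. Each iterate has norm at most r, so every step gains a
    factor r. *)
Lemma sqrt_iter_diff m x : opb (r ^+ m.+1) (mact (D m) x).
Proof.
elim: m => [|m IH].
  have -> : mact (D 0%N) x = fun u => (2^-1)%:C *: mact a x u.
    apply/funext => u; rewrite mactP mact_sqrt_iter !mact0.
    by rewrite scaler0 add0r addr0.
  apply: (@opbW _ _ _ (2^-1 * r)); first by rewrite expr1; have := r0; lra.
  by apply: opbZ; [rewrite invr_ge0|exact: ar].
have -> : mact (D m.+1) x = fun u => (2^-1)%:C *:
    (mact (sqrt_iter m.+1) x (mact (D m) x u) + mact (D m) x (mact (sqrt_iter m) x u)).
  apply/funext => u; rewrite [LHS]mactP.
  have E1 := mact_sqrt_iter m.+1 x u; have E0 := mact_sqrt_iter m x u.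
  rewrite {}E1 {1}E0 [mact (D m) x u]mactP [mact (D m) x (mact _ _ _)]mactP mact_linear.
  rewrite !scaleN1r -scalerN -scalerDr; congr (_ *: _).
  rewrite opprD addrACA addNr add0r.
  by rewrite [RHS]addrC -[RHS]addrA addNKr.
have -> : r ^+ m.+2 = 2^-1 * (r * r ^+ m.+1 + r ^+ m.+1 * r).
  by rewrite [r ^+ m.+2]exprS; field.
apply: opbZ; first by rewrite invr_ge0.
by apply: opbD; apply: opb_comp => //; try exact: exprn_gt0; exact: sqrt_iter_opb.
Qed.

(** The limit Y of the iterates is self-adjoint and satisfies 2 Y = a + Y^2, so Z = 1 - Y has Z^2 =
    1 - 2 Y + Y^2 = 1 - a. Its entries stay in [B] because [B] is closed. *)
Theorem msqrt : exists Z : mat, (forall i j, B (Z i j)) /\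
  forall i j, mone i j - a i j = mmul (madj Z) Z i j.
Proof.
have cv i j : exists l : A, sqrt_iter m i j @[m --> \oo] --> l.
  apply: (geometric_cvg r01) => m.
  rewrite addrC -[- _]scaleN1r; apply: (opb_entry (Y := D m)).
    by apply: exprn_gt0.
  exact: sqrt_iter_diff.
pose Y i j := sval (cid (cv i j)).
have Ycv i j : sqrt_iter m i j @[m --> \oo] --> Y i j by rewrite /Y; case: cid.
have [clB B1 BP BM _] := subB.
have YB i j : B (Y i j).
  apply: (closed_cvg B clB _ _ (Ycv i j)).
  by apply: nearW => m; exact: sqrt_iter_sub.
have Ysym i j : star (Y i j) = Y j i.
  have h : star (sqrt_iter m i j) @[m --> \oo] --> star (Y i j) by exact: star_cvg.
  have e : (fun m => star (sqrt_iter m i j)) = (fun m => sqrt_iter m j i).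
    by apply/funext => m; exact: sqrt_iter_sym.
  rewrite e in h; exact: norm_cvg_unique h (Ycv j i).
have YE i j : Y i j = (2^-1)%:C *: (a i j + mmul Y Y i j).
  have h1 : sqrt_iter m.+1 i j @[m --> \oo] --> Y i j.
    by rewrite (cvg_shiftS (fun m => sqrt_iter m i j)); exact: Ycv.
  have h2 : sqrt_iter m.+1 i j @[m --> \oo] --> (2^-1)%:C *: (a i j + mmul Y Y i j).
    apply: cvgZr; apply: cvgD; first exact: cvg_cst.
    have cs (I : Type) (s : seq I) (F : nat -> I -> A) (l : I -> A) :
        (forall k, F m k @[m --> \oo] --> l k) ->
        \sum_(k <- s) F m k @[m --> \oo] --> \sum_(k <- s) l k.
      move=> Fl; elim: s => [|k s IH].
        by rewrite big_nil; under eq_fun do rewrite big_nil; exact: cvg_cst.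
      by rewrite big_cons; under eq_fun do rewrite big_cons; exact: cvgD.
    by apply: cs => k; apply: cmul_cvg; exact: Ycv.
  exact: norm_cvg_unique h1 h2.
have YE2 i j : a i j = 2%:R%:C *: Y i j - mmul Y Y i j.
  by rewrite [in X in X - _]YE scalerA -rmorphM mulfV// scale1r addrK.
exists (fun i j => mone i j - Y i j); split.
  move=> i j; have B0 := subalg0 subB.
  have Bm : B (mone i j) by rewrite /mone; case: ifP.
  by have := BP (-1) _ _ (YB i j) Bm; rewrite scaleN1r addrC.
move=> i j.
have E k : cmul (madj (fun i j => mone i j - Y i j) i k) (mone k j - Y k j) =
    cmul (mone i k) (mone k j) - cmul (mone i k) (Y k j)
    - (cmul (Y i k) (mone k j) - cmul (Y i k) (Y k j)).
  rewrite /madj starD starN Ysym.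
  rewrite star_mone.
  by rewrite cmulDl !cmulDr !cmulNl !cmulNr opprK opprB [- _ + _ in LHS]addrC.
rewrite [RHS](eq_bigr _ (fun k _ => E k)) !sumrB.
rewrite [RHS](_ : _ = mmul mone mone i j - mmul mone Y i j -
  (mmul Y mone i j - mmul Y Y i j))// !mmul1l mmul1r.
rewrite YE2 rmorph_nat scaler_nat mulr2n /mmul.
by rewrite -[Y i j + _ - _]addrA opprD addrA.
Qed.

End msqrt.

(** * Completely positive maps as positive functionals *)

Section ucp_positivity.
Variables (R : realType) (X : topologicalType) (H : hilbertType R) (n : nat).
Local Notation A := (cbfun X (bop H)).
Local Notation mat := ('I_n -> 'I_n -> A).
Variable B : set A.
Hypothesis subB : cstar_subalgebra B.
Variable phi : A -> 'M[R[i]]_n.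
Hypothesis ucp : ucp_on B n phi.
Implicit Types (Y Z : mat).

(* The positive functional on M_n(B) that corresponds to phi. *)
Definition choi_functional Y : R[i] := \sum_i \sum_j phi (Y i j) i j.
Local Notation s := choi_functional.

Lemma ReC (t : R) : Re t%:C = t. Proof. by []. Qed.

Lemma qform_sum (v w : 'cV[R[i]]_n) (M : 'M[R[i]]_n) :
  ((map_mx Num.conj v)^T *m M *m w) ord0 ord0 =
  \sum_i \sum_j Num.conj (v i ord0) * M i j * w j ord0.
Proof.
rewrite !mxE exchange_big/=; apply: eq_bigr => j _; rewrite !mxE mulr_suml.
by apply: eq_bigr => i _; rewrite !mxE.
Qed.

Lemma qform_delta (M : 'M[R[i]]_n) i j :
  ((map_mx Num.conj (delta_mx i ord0 : 'cV_n))^T *m M *m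
    (delta_mx j ord0 : 'cV_n)) ord0 ord0 = M i j.
Proof.
rewrite qform_sum (bigD1 i)//= (bigD1 j)//= !mxE !eqxx !big1 ?addr0.
- by rewrite conjC1 mul1r mulr1.
- move=> k /negbTE ki; rewrite big1// => l _.
  by rewrite !mxE ki conjC0 !mul0r.
- by move=> k /negbTE kj; rewrite !mxE kj mulr0.
Qed.

(** Complete positivity with k = n blocks, tested on the standard basis vectors: the i-th and j-th
    of them pick the entry (i, j) of the block (i, j). *)
Lemma choi_psd Z : (forall i j, B (Z i j)) -> 0 <= s (mmul (madj Z) Z).
Proof.
case: ucp => _ _ psd BZ.
have := psd n Z BZ (fun i => delta_mx i ord0 : 'cV_n).
congr (0 <= _); apply: eq_bigr => i _; apply: eq_bigr => j _.
exact: qform_delta.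
Qed.

Lemma choiP k Y Z : (forall i j, B (Y i j)) -> (forall i j, B (Z i j)) ->
  s (fun i j => k *: Y i j + Z i j) = k * s Y + s Z.
Proof.
case: ucp => lin _ _ BY BZ; rewrite /choi_functional.
rewrite mulr_sumr -big_split; apply: eq_bigr => i _.
rewrite mulr_sumr -big_split; apply: eq_bigr => j _.
by rewrite lin// !mxE.
Qed.

Lemma phi0 : phi 0 = 0.
Proof.
case: ucp => lin _ _; have B0 := subalg0 subB.
by have := lin (-1) _ _ B0 B0; rewrite !scaleN1r !addNr.
Qed.

Lemma mone_sub i j : B ((mone : mat) i j).
Proof. by rewrite /mone; case: ifP => _; [case: subB|exact: subalg0]. Qed.

Lemma mmul_sub Y Z : (forall i j, B (Y i j)) -> (forall i j, B (Z i j)) ->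
  forall i j, B (mmul Y Z i j).
Proof.
by move=> BY BZ i j; apply: (subalg_sum subB) => k; case: subB => _ _ _ BM _; exact: BM.
Qed.

Lemma madj_sub Y : (forall i j, B (Y i j)) -> forall i j, B (madj Y i j).
Proof. by move=> BY i j; case: subB => _ _ _ _; exact. Qed.

(* Positivity at 1 + iY forces the functional to be real on i(Y - Y^* ). *)
Lemma choi_adj Y : (forall i j, B (Y i j)) -> Re (s (madj Y)) = Re (s Y).
Proof.
move=> BY; pose I : R[i] := 0 +i* 1.
have cI : Num.conj I = - I by rewrite /I; apply/eqP; rewrite eq_complex/= oppr0 !eqxx.
have II : (- I) * I = 1 by apply/eqP; rewrite eq_complex/=; apply/andP; split; apply/eqP; ring.
pose W : mat := fun i j => I *: Y i j + mone i j.
have BW i j : B (W i j) by apply: subalgP => //; exact: mone_sub.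
have E : mmul (madj W) W = fun i j => 1 *: mmul (madj Y) Y i j +
    ((- I) *: madj Y i j + (I *: Y i j + mone i j)).
  apply/funext => i; apply/funext => j.
  rewrite -(mmul1r (madj Y) i j) -(mmul1l Y i j) -[mone i j in RHS]mmul1l /mmul.
  rewrite scale1r !scaler_sumr -!big_split; apply: eq_bigr => k _ /=.
  rewrite /madj /W starP star_mone cI cmulDl !cmulDr !cmulZl !cmulZr scalerA II scale1r.
  by rewrite !addrA.
have := choi_psd BW; have := choi_psd BY; rewrite E.
have BYY := mmul_sub (madj_sub BY) BY; have BYs := madj_sub BY.
have B1 := mone_sub.
have := @choi_psd mone B1.
have -> : mmul (madj mone) mone = mone :> mat.
  by apply/funext => i; apply/funext => j; rewrite mmul1r; exact: star_mone.
rewrite !choiP//; do ?by move=> i j; do ?apply: subalgP.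
rewrite mul1r /I; move: (s _) (s _) (s _) (s _) => [a a'] [b b'] [c c'] [e e'].
rewrite !lecE/= => /andP[/eqP h1 _] /andP[/eqP h2 _] /andP[/eqP h3 _].
by move: h1 h2 h3; lra.
Qed.

Definition mform Y (w : X * ('I_n -> H)) : R[i] := vip (mact Y w.1 w.2) w.2.

Lemma vip_bound (y : 'I_n -> H) (T : bop H) i j :
  rnorm (inner (T (y j)) (y i)) <= rnorm T * vnsq y.
Proof.
rewrite (le_trans (CauchySchwarz_inner _ _))//.
rewrite (le_trans (ler_wpM2r (rnorm_ge0 _) (bop_le _ _)))// -mulrA.
rewrite ler_wpM2l ?rnorm_ge0//.
have h k : rnorm (y k) ^+ 2 <= vnsq y.
  by rewrite /vnsq (bigD1 k)//= lerDl sumr_ge0// => l _; exact: sqr_ge0.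
have := h i; have := h j; have := sqr_ge0 (rnorm (y i) - rnorm (y j)).
by move: (rnorm (y i)) (rnorm (y j)) => a b; nra.
Qed.

Lemma rnorm_sum (V : normedZmodType R[i]) (I : Type) (t : seq I) (F : I -> V) :
  rnorm (\sum_(i <- t) F i) <= \sum_(i <- t) rnorm (F i).
Proof.
elim/big_rec2: _ => [|i y1 y2 _ h]; first by rewrite rnorm0.
by rewrite (le_trans (ler_rnormD _ _))// lerD2l.
Qed.

Lemma mform_bound Y w :
  rnorm (mform Y w) <= (\sum_i \sum_j rnorm (Y i j)) * vnsq w.2.
Proof.
rewrite (le_trans (rnorm_sum _ _))// mulr_suml; apply: ler_sum => i _.
rewrite /mact inner_suml (le_trans (rnorm_sum _ _))// mulr_suml.
apply: ler_sum => j _; rewrite (le_trans (vip_bound _ _ _ _))//.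
by rewrite ler_wpM2r ?vnsq_ge0// cbfun_le.
Qed.

Lemma mformP k Y Z w : mform (fun i j => k *: Y i j + Z i j) w = k * mform Y w + mform Z w.
Proof. by rewrite /mform mactP vipDl vipZl. Qed.

Lemma mform_adj Y w : Re (mform (madj Y) w) = Re (mform Y w).
Proof. by rewrite /mform mact_adj Re_vipC. Qed.

Lemma mform1 w : mform mone w = (vnsq w.2)%:C.
Proof. by rewrite /mform mact1 vnsqE. Qed.

(** Y need be neither self-adjoint nor of the form Z^* Z. Its real part plus e, divided by a large
    c, is 1 - a with 0 <= a <= r < 1 as forms; [msqrt] factors it, and e tends to 0. By [choi_adj]
    passing to the real part does not change the real part of the functional. *)
Theorem choi_ge0 Y : (forall i j, B (Y i j)) -> (forall w, 0 <= Re (mform Y w)) ->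
  0 <= Re (s Y).
Proof.
move=> BY Y0.
have s1 : s mone = n%:R%:C.
  case: ucp => _ u1 _; rewrite /choi_functional.
  rewrite rmorph_nat -[n in RHS]card_ord -sumr_const; apply: eq_bigr => i _.
  rewrite (bigD1 i)//= {1}/mone eqxx u1 mxE eqxx big1 ?addr0// => j ij.
  rewrite /mone eq_sym (negbTE ij).
  by rewrite phi0 mxE.
apply/ler_addgt0Pr => e' e'0.
(* The unit matrix has functional value n, so a shift by e costs e n; the denominator n + 1 also
   covers n = 0. *)
pose e := e' / n.+1%:R.
have e0 : 0 < e by rewrite divr_gt0.
have en : e * n%:R <= e'.
  by rewrite /e mulrAC ler_pdivrMr// ler_wpM2l ?ler_nat// ltW.
pose K := \sum_i \sum_j rnorm (Y i j).
have K0 : 0 <= K by apply: sumr_ge0 => i _; apply: sumr_ge0 => j _; exact: rnorm_ge0.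
(* One e gives K / c <= r; the second keeps r positive even when K = 0. *)
pose c := K + 2 * e.
have c0 : 0 < c by rewrite /c; lra.
pose k1 := - (2 * c)^-1; pose k2 := - (e / c); pose r := 1 - e / c.
have ec : e / c < 1 by rewrite ltr_pdivrMr// /c; lra.
have ec0 : 0 < e / c by rewrite divr_gt0.
have r01 : 0 < r < 1 by rewrite /r; apply/andP; split; lra.
pose a : mat := fun i j => k1%:C *: Y i j + (k1%:C *: madj Y i j +
  (k2%:C *: mone i j + mone i j)).
have B1 := mone_sub; have BYs := madj_sub BY.
have Ba i j : B (a i j) by do 3?apply: subalgP.
have asym i j : star (a i j) = a j i.
  by rewrite /a !starP !conj_real !star_mone /madj starK addrCA.
have aform w : Re (mform a w) = r * vnsq w.2 - c^-1 * Re (mform Y w).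
  rewrite !mformP mform1 !cReD !cReM mform_adj !ReC.
  rewrite /k1 /k2 /r; move: (Re _) (vnsq _) => f q.
  field.
  by rewrite gt_eqF.
have ar x : opb r (mact a x).
  have /andP[r0 r1] := r01.
  apply: contr_opb => // u; apply: psd_contr => //.
  - by move=> k y z; exact: mact_linear.
  - move=> y z; rewrite -mact_adj; congr (vip (mact _ _ _) _).
    by apply/funext => i; apply/funext => j; rewrite /madj asym.
  - move=> y; have := aform (x, y); rewrite /mform/= => ->.
    have := Y0 (x, y); have := mform_bound Y (x, y).
    move=> /(le_trans (Re_le_rnorm _)) /=; rewrite -/K /mform/=.
    move: (Re _) (vnsq_ge0 y); move: (vnsq y) => q f q0 fK f0.
    have cf : c^-1 * f <= r * q.
      by rewrite ler_pdivrMl// /r mulrA mulrBr mulr1 mulrCA divff ?gt_eqF// /c; nra.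
    have : 0 <= c^-1 * f by rewrite mulr_ge0// invr_ge0 ltW.
    by move: cf; set t := c^-1 * f; lra.
have [Z [BZ ZE]] := msqrt subB r01 Ba asym ar.
have := choi_psd BZ.
have <- : (fun i j => (-1) *: a i j + mone i j) = mmul (madj Z) Z.
  by apply/funext => i; apply/funext => j; rewrite -ZE scaleN1r addrC.
rewrite choiP// lecE => /andP[_]; rewrite raddfD/= mulN1r raddfN/=.
rewrite !choiP//; do ?by move=> i j; do 3?apply: subalgP.
rewrite s1 !cReD !cReM ReC choi_adj//.
have -> : - (k1 * Re (s Y) + (k1 * Re (s Y) + (k2 * n%:R + n%:R))) + n%:R =
    c^-1 * (Re (s Y) + e * n%:R).
  by rewrite /k1 /k2; field; rewrite gt_eqF.
rewrite pmulr_rge0 ?invr_gt0//; move: en; lra.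
Qed.

End ucp_positivity.

(** * Completely positive maps as finitely additive integrals *)

Lemma Re_mulNi (R : realType) (z : R[i]) : Re ((0 -i* 1) * z) = Im z.
Proof. by case: z => b c /=; ring. Qed.

Lemma Re_mulD (R : realType) (k z z' : R[i]) :
  Re (k * z + z') = Re k * Re z + (- Im k * Im z + Re z').
Proof. by case: k z z' => a b [c e] [c' e'] /=; ring. Qed.

Lemma Im_mulD (R : realType) (k z z' : R[i]) :
  Im (k * z + z') = Re k * Im z + (Im k * Re z + Im z').
Proof. by case: k z z' => a b [c e] [c' e'] /=; ring. Qed.

Lemma abs_Re_le_rnorm (R : realType) (z : R[i]) : `|Re z| <= rnorm z.
Proof. by rewrite -lecR rnormE normc_ge_Re. Qed.

Lemma abs_Im_le_rnorm (R : realType) (z : R[i]) : `|Im z| <= rnorm z.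
Proof.
have i1 : rnorm (0 -i* 1 : R[i]) = 1.
  apply: complexI; rewrite rnormE; apply/eqP.
  rewrite -sqrp_eq1// sqr_normc/= eq_complex/=.
  by apply/andP; split; apply/eqP; ring.
by rewrite -Re_mulNi (le_trans (abs_Re_le_rnorm _))// rnormM i1 mul1r.
Qed.

Section ucp_integral.
Variables (R : realType) (X : topologicalType) (H : hilbertType R) (n : nat).
Local Notation A := (cbfun X (bop H)).
Local Notation mat := ('I_n -> 'I_n -> A).
Local Notation Omega := (X * ('I_n -> H))%type.
Implicit Types (w : Omega) (h : Omega -> R[i]).

Definition wsq w : R := vnsq w.2.

(** Besides the forms of matrices over [A], this contains the functions <T_x xi_j, xi_i> for every
    bounded family T, however irregular in x. *)
Definition quad_bounded h := exists C : R, forall w, rnorm (h w) <= C * wsq w.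

Lemma quad_boundedP k h h' : quad_bounded h -> quad_bounded h' ->
  quad_bounded (fun w => k * h w + h' w).
Proof.
move=> [C hC] [D hD]; exists (rnorm k * C + D) => w.
rewrite (le_trans (ler_rnormD _ _))// mulrDl lerD// rnormM -mulrA.
by rewrite ler_wpM2l ?rnorm_ge0.
Qed.

Definition quad_bounded_real (g : Omega -> R) := exists C : R, forall w, `|g w| <= C * wsq w.

Lemma quad_bounded_Re h : quad_bounded h -> quad_bounded_real (fun w => Re (h w)).
Proof. by move=> [C hC]; exists C => w; apply: le_trans (hC w); exact: abs_Re_le_rnorm. Qed.

Lemma quad_bounded_Im h : quad_bounded h -> quad_bounded_real (fun w => Im (h w)).
Proof. by move=> [C hC]; exists C => w; apply: le_trans (hC w); exact: abs_Im_le_rnorm. Qed.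

Lemma quad_bounded_realP k (g g' : Omega -> R) :
  quad_bounded_real g -> quad_bounded_real g' ->
  quad_bounded_real (fun w => k * g w + g' w).
Proof.
move=> [C gC] [D gD]; exists (`|k| * C + D) => w.
rewrite (le_trans (ler_normD _ _))// mulrDl lerD// normrM -mulrA.
by rewrite ler_wpM2l.
Qed.

Lemma quad_bounded_mform (Y : mat) : quad_bounded (mform Y).
Proof. by exists (\sum_i \sum_j rnorm (Y i j)) => w; exact: mform_bound. Qed.

Section functional.
Variables (B : set A) (phi : A -> 'M[R[i]]_n).
Hypotheses (subB : cstar_subalgebra B) (ucp : ucp_on B n phi).

Let V := (Omega -> R^o)%type.
Let P : set V := [set g | forall w, 0 <= g w].
Let E : set V := [set g | quad_bounded_real g].
(** That matrices with the same form get the same value is never checked directly: it follows from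
    positivity of the graph. *)
Let G0 : set (V * R) := [set p | exists Y : mat, [/\ forall i j, B (Y i j),
  p.1 = (fun w => Re (mform Y w)) & p.2 = Re (choi_functional phi Y)]].

Lemma convex_cone_ge0 : convex_cone P.
Proof.
split => [w|f g Pf Pg w|k f k0 Pf w]; first exact: lexx.
  by apply: addr_ge0; [exact: Pf|exact: Pg].
by apply: mulr_ge0 => //; exact: Pf.
Qed.

Lemma linear_graph_choi : linear_graph G0.
Proof.
have B0 := subalg0 subB.
split.
  exists (fun _ _ => 0); split => //=.
    apply/funext => w; rewrite /mform /vip big1// => i _.
    by rewrite /mact big1// inner0l.
  rewrite /choi_functional big1// => i _; rewrite big1// => j _.
  by rewrite (phi0 subB ucp) mxE.
move=> k f r g s [Y [BY /= -> ->]] [Z [BZ /= -> ->]].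
exists (fun i j => k%:C *: Y i j + Z i j); split => /=.
- by move=> i j; exact: subalgP.
- by apply/funext => w; rewrite mformP cReD cReM.
- by rewrite (choiP ucp)// cReD cReM.
Qed.

Lemma mform_mone (C : R) w :
  Re (mform (fun i j => C%:C *: mone i j + 0 : A) w) = C * wsq w.
Proof.
rewrite mformP cReD cReM mform1 ReC.
rewrite [mform _ _]big1 ?addr0// => i _.
by rewrite /mact big1// inner0l.
Qed.

Lemma quad_bounded_choi (f : V) : E f -> exists g r, G0 (g, r) /\ P (g - f).
Proof.
move=> [C fC]; have B0 := subalg0 subB.
exists (fun w => C * wsq w), (Re (choi_functional phi (fun i j => C%:C *: mone i j + 0))).
split; last first.
  by move=> w; rewrite [leRHS](_ : _ = C * wsq w - f w)// subr_ge0 (le_trans (ler_norm _)).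
exists (fun i j => C%:C *: mone i j + 0); split => //=.
  by move=> i j; apply: subalgP => //; exact: mone_sub.
by apply/funext => w; rewrite mform_mone.
Qed.

Lemma ucp_real_functional : exists f : (Omega -> R) -> R,
  [/\ forall k g g', quad_bounded_real g -> quad_bounded_real g' ->
        f (fun w => k * g w + g' w) = k * f g + f g',
      forall g, quad_bounded_real g -> (forall w, 0 <= g w) -> 0 <= f g &
      forall Y, (forall i j, B (Y i j)) ->
        f (fun w => Re (mform Y w)) = Re (choi_functional phi Y)].
Proof.
have pG : positive_graph P G0.
  by move=> f r [Y [BY /= -> ->]] Pf; exact: (choi_ge0 subB ucp).
have E0 : E 0 by exists 0 => w; rewrite mul0r normr0.
have EP k f g : E f -> E g -> E (k *: f + g) by exact: quad_bounded_realP.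
have [f [fP f_ge0 fG]] := riesz_extension convex_cone_ge0 linear_graph_choi pG E0 EP
  quad_bounded_choi.
exists f; split => [k g g' qg qg'|g qg g0|Y BY]; [exact: fP|exact: f_ge0|].
by apply: fG; [exact/quad_bounded_Re/quad_bounded_mform|exists Y].
Qed.

(** The real functional sees only real parts of forms; k = 1 and k = -i recover the real and the
    imaginary part of an entry of [phi a]. *)
Definition entry_mx (a : A) (i j : 'I_n) (k : R[i]) : mat :=
  fun i' j' => if (i' == i) && (j' == j) then k *: a else 0.

Lemma choi_entry (a : A) i j k : B a ->
  choi_functional phi (entry_mx a i j k) = k * phi a i j.
Proof.
move=> Ba; have phiZ : phi (k *: a) = k *: phi a.
  have [lin _ _] := ucp; have := lin k a 0 Ba (subalg0 subB).
  by rewrite (phi0 subB ucp) !addr0.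
have entryE i' j' : phi (entry_mx a i j k i' j') i' j' =
    if (i' == i) && (j' == j) then k * phi a i' j' else 0.
  by rewrite /entry_mx; case: ifP => _; rewrite ?phiZ ?(phi0 subB ucp) mxE.
rewrite /choi_functional (bigD1 i)//= [X in _ + X]big1 => [|i' /negbTE ii]; last first.
  by apply: big1 => j' _; rewrite entryE ii.
rewrite addr0 (bigD1 j)//= big1 ?addr0 => [|j' /negbTE jj]; last by rewrite entryE jj andbF.
by rewrite entryE !eqxx.
Qed.

Lemma mform_entry (a : A) i j k w :
  mform (entry_mx a i j k) w = k * inner (a w.1 (w.2 j)) (w.2 i).
Proof.
have entryE i' : mact (entry_mx a i j k) w.1 w.2 i' =
    if i' == i then k *: a w.1 (w.2 j) else 0.
  rewrite /mact; case: eqP => [->|/eqP/negbTE ii]; last first.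
    by apply: big1 => j' _; rewrite /entry_mx ii.
  rewrite (bigD1 j)//= big1 => [|j' /negbTE jj]; last by rewrite /entry_mx jj andbF.
  by rewrite addr0 /entry_mx !eqxx.
rewrite /mform /vip (bigD1 i)//= big1 => [|i' /negbTE ii]; last first.
  by rewrite entryE ii inner0l.
by rewrite addr0 entryE eqxx innerZl.
Qed.

(* A finitely additive Stinespring dilation: [I] integrates against a positive
   functional on the space of pairs (x, xi) with x in X and xi in H^n. *)
Theorem ucp_integral : exists I : (Omega -> R[i]) -> R[i],
  [/\ forall k h h', quad_bounded h -> quad_bounded h' ->
        I (fun w => k * h w + h' w) = k * I h + I h',
      forall h, quad_bounded h -> (forall w, 0 <= h w) -> 0 <= I h,
      forall h, quad_bounded h -> (forall w, 0 <= Re (h w)) -> 0 <= Re (I h) &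
      forall a i j, B a -> phi a i j = I (fun w => inner (a w.1 (w.2 j)) (w.2 i))].
Proof.
have B0 := subalg0 subB.
have [f [fP f_ge0 fG]] := ucp_real_functional.
have f0 : f (fun=> 0) = 0.
  have E0 : quad_bounded_real (fun=> 0) by exists 0 => w; rewrite mul0r normr0.
  rewrite -[RHS](addNr (f (fun=> 0))) -[X in X + _]mulN1r -fP//.
  by congr f; apply/funext => w; rewrite mulr0 addr0.
exists (fun h => f (fun w => Re (h w)) +i* f (fun w => Im (h w))); split.
- move=> k h h' qh qh'.
  have := (quad_bounded_Re qh, quad_bounded_Im qh, quad_bounded_Re qh', quad_bounded_Im qh').
  move=> [[[Eu Ev] Eu'] Ev'].
  have -> : (fun w => Re (k * h w + h' w)) =
      fun w => Re k * Re (h w) + (- Im k * Im (h w) + Re (h' w)).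
    by apply/funext => w; exact: Re_mulD.
  have -> : (fun w => Im (k * h w + h' w)) =
      fun w => Re k * Im (h w) + (Im k * Re (h w) + Im (h' w)).
    by apply/funext => w; exact: Im_mulD.
  rewrite (fP _ _ _ Eu (quad_bounded_realP _ Ev Eu')) (fP _ _ _ Ev Eu').
  rewrite (fP _ _ _ Ev (quad_bounded_realP _ Eu Ev')) (fP _ _ _ Eu Ev').
  by apply/eqP; rewrite eq_complex Re_mulD Im_mulD !eqxx.
- move=> h qh h0.
  have -> : (fun w => Im (h w)) = (fun=> 0).
    by apply/funext => w; have := h0 w; rewrite lecE/= => /andP[/eqP].
  rewrite f0 ler0c; apply: f_ge0; first exact: quad_bounded_Re.
  by move=> w; have := h0 w; rewrite lecE/= => /andP[].
- by move=> h qh h0; apply: f_ge0; first exact: quad_bounded_Re.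
move=> a i j Ba.
have fM k : f (fun w => Re (k * inner (a w.1 (w.2 j)) (w.2 i))) = Re (k * phi a i j).
  rewrite -choi_entry// -fG => [|i' j'].
    by congr f; apply/funext => w; rewrite mform_entry.
  by rewrite /entry_mx; case: ifP => // _; exact: subalgZ.
apply/eqP; rewrite eq_complex; apply/andP; split; apply/eqP => /=.
  have := fM 1; rewrite mul1r => <-; congr f; apply/funext => w.
  by rewrite mul1r.
by rewrite -Re_mulNi -fM; congr f; apply/funext => w; rewrite Re_mulNi.
Qed.

End functional.

End ucp_integral.

(** * Perturbing a completely positive map by unitaries *)

Section ucp_perturb.
Variables (R : realType) (X : topologicalType) (H : hilbertType R) (n : nat).
Local Notation A := (cbfun X (bop H)).
Local Notation Omega := (X * ('I_n -> H))%type.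
Implicit Types (h : Omega -> R[i]) (u v : 'cV[R[i]]_n) (T : X -> bop H).

Variables (B : set A) (phi : A -> 'M[R[i]]_n).
Hypotheses (subB : cstar_subalgebra B) (ucp : ucp_on B n phi).

Section integral.
Variable I : (Omega -> R[i]) -> R[i].
Hypothesis IP : forall k h h', quad_bounded h -> quad_bounded h' ->
  I (fun w => k * h w + h' w) = k * I h + I h'.
Hypothesis I_ge0 : forall h, quad_bounded h -> (forall w, 0 <= h w) -> 0 <= I h.
Hypothesis I_Re_ge0 : forall h, quad_bounded h -> (forall w, 0 <= Re (h w)) -> 0 <= Re (I h).
Hypothesis I_phi : forall a i j, B a ->
  phi a i j = I (fun w => inner (a w.1 (w.2 j)) (w.2 i)).

Lemma quad_bounded0 : quad_bounded (fun _ : Omega => 0 : R[i]).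
Proof. by exists 0 => w; rewrite rnorm0 mul0r. Qed.

Lemma integral0 : I (fun=> 0) = 0.
Proof.
rewrite -[RHS](addNr (I (fun=> 0))) -[X in X + _]mulN1r -IP; [|exact: quad_bounded0..].
by congr I; apply/funext => w; rewrite mulr0 addr0.
Qed.

Lemma integralZ k h : quad_bounded h -> I (fun w => k * h w) = k * I h.
Proof.
move=> qh; rewrite -[RHS]addr0 -integral0 -IP//; last exact: quad_bounded0.
by congr I; apply/funext => w; rewrite addr0.
Qed.

Lemma quad_boundedZ k h : quad_bounded h -> quad_bounded (fun w => k * h w).
Proof.
move=> qh; have := quad_boundedP k qh quad_bounded0.
by congr quad_bounded; apply/funext => w; rewrite addr0.
Qed.

Lemma quad_bounded_sum (J : Type) (s : seq J) (F : J -> Omega -> R[i]) :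
  (forall j, quad_bounded (F j)) -> quad_bounded (fun w => \sum_(j <- s) F j w).
Proof.
move=> qF; elim: s => [|j s IH].
  by under eq_fun do rewrite big_nil; exact: quad_bounded0.
under eq_fun do rewrite big_cons -[F j _]mul1r.
exact: quad_boundedP.
Qed.

Lemma integral_sum (J : Type) (s : seq J) (F : J -> Omega -> R[i]) :
  (forall j, quad_bounded (F j)) ->
  I (fun w => \sum_(j <- s) F j w) = \sum_(j <- s) I (F j).
Proof.
move=> qF; elim: s => [|j s IH].
  by under eq_fun do rewrite big_nil; rewrite big_nil integral0.
under eq_fun do rewrite big_cons -[F j _]mul1r.
by rewrite IP ?big_cons ?mul1r ?IH//; exact: quad_bounded_sum.
Qed.

Definition lcomb v (y : 'I_n -> H) : H := \sum_j v j ord0 *: y j.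

Definition sform T v u : Omega -> R[i] :=
  fun w => inner (T w.1 (lcomb v w.2)) (lcomb u w.2).

(** The extension of [phi] to families of operators with no continuity in x: by [kernel_mx_phi] it
    agrees with [phi] on [B]. *)
Definition kernel_mx T : 'M[R[i]]_n :=
  \matrix_(i, j) I (fun w => inner (T w.1 (w.2 j)) (w.2 i)).

Definition fam_bounded T := exists C : R, forall x, rnorm (T x) <= C.

Lemma quad_bounded_fam T i j : fam_bounded T ->
  quad_bounded (fun w : Omega => inner (T w.1 (w.2 j)) (w.2 i)).
Proof.
move=> [C TC]; exists C => w; apply: le_trans (vip_bound _ _ _ _) _.
by rewrite ler_wpM2r ?vnsq_ge0.
Qed.

Lemma sformE T v u : sform T v u = fun w => \sum_i \sum_j
  (Num.conj (u i ord0) * v j ord0) * inner (T w.1 (w.2 j)) (w.2 i).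
Proof.
apply/funext => w; rewrite /sform [lcomb u _]/lcomb inner_sumr.
apply: eq_bigr => i _; rewrite innerZr /lcomb bop_sumr inner_suml mulr_sumr.
by apply: eq_bigr => j _; rewrite bopZ innerZl mulrA.
Qed.

Lemma quad_bounded_sform T v u : fam_bounded T -> quad_bounded (sform T v u).
Proof.
move=> bT; rewrite sformE; apply: quad_bounded_sum => i; apply: quad_bounded_sum => j.
exact/quad_boundedZ/quad_bounded_fam.
Qed.

Lemma integral_sform T v u : fam_bounded T ->
  I (sform T v u) = ((map_mx Num.conj u)^T *m kernel_mx T *m v) ord0 ord0.
Proof.
move=> bT; rewrite qform_sum sformE.
rewrite integral_sum => [|i]; last first.
  by apply: quad_bounded_sum => j; exact/quad_boundedZ/quad_bounded_fam.
apply: eq_bigr => i _; rewrite integral_sum => [|j]; last first.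
  exact/quad_boundedZ/quad_bounded_fam.
apply: eq_bigr => j _; rewrite integralZ ?mxE; last exact: quad_bounded_fam.
by rewrite mulrAC.
Qed.

Lemma kernel_mxP k T T' : fam_bounded T -> fam_bounded T' ->
  kernel_mx (fun x => k *: T x + T' x) = k *: kernel_mx T + kernel_mx T'.
Proof.
move=> bT bT'; apply/matrixP => i j; rewrite !mxE -IP; try exact: quad_bounded_fam.
by congr I; apply/funext => w; rewrite bopPE innerPl.
Qed.

Lemma kernel_mx_phi (a : A) : B a -> kernel_mx a = phi a.
Proof. by move=> Ba; apply/matrixP => i j; rewrite mxE I_phi. Qed.

Lemma fam_bounded_cbfun (a : A) : fam_bounded a.
Proof. by exists (rnorm a) => x; exact: cbfun_le. Qed.

Definition vsq v : R := \sum_i rnorm (v i ord0) ^+ 2.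

(** Unitality of [phi] makes the coordinates xi_1, ..., xi_n orthonormal for the integral. Hence no
    constant depending on n enters the norm bound below. *)
Lemma integral_lcomb v : I (sform (fun=> cone) v v) = (vsq v)%:C.
Proof.
have bc : fam_bounded (fun=> cone) by exists (rnorm (cone : bop H)).
rewrite integral_sform// (_ : kernel_mx _ = 1%:M); last first.
  case: ucp => _ <- _; rewrite -kernel_mx_phi//; by case: subB.
rewrite mulmx1 mxE rmorph_sum; apply: eq_bigr => i _.
by rewrite !mxE mulJ_rnorm.
Qed.

(** The integral of the pointwise inequality 2 Re <T a, b> <= e (|a|^2 + |b|^2), where a and b are
    the combinations of the xi_j with coefficients v and u. *)
Lemma kernel_mx_bound T (e : R) v u : 0 <= e -> (forall x, rnorm (T x) <= e) ->
  2 * Re (((map_mx Num.conj u)^T *m kernel_mx T *m v) ord0 ord0) <= e * (vsq v + vsq u).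
Proof.
move=> e0 Te; have bT : fam_bounded T by exists e.
have bc : fam_bounded (fun=> cone) by exists (rnorm (cone : bop H)).
have qv := quad_bounded_sform v v bc; have qu := quad_bounded_sform u u bc.
have qT := quad_bounded_sform v u bT.
have := @I_Re_ge0 (fun w => (- 2)%:C * sform T v u w +
  (e%:C * sform (fun=> cone) v v w + e%:C * sform (fun=> cone) u u w)).
have q2 := quad_boundedP e%:C qv (quad_boundedZ e%:C qu).
have q1 := quad_boundedP (- 2)%:C qT q2.
move=> /(_ q1).
rewrite (IP _ qT q2) (IP _ qv (quad_boundedZ e%:C qu)) integralZ// !integral_lcomb integral_sform//.
rewrite !cReD !cReM !ReC => H1.
suff : 0 <= - 2 * Re (((map_mx Num.conj u)^T *m kernel_mx T *m v) ord0 ord0) +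
    (e * vsq v + e * vsq u) by lra.
apply: H1 => w; rewrite !cReD !cReM.
rewrite /sform !inner_rnorm !ReC.
set a := lcomb v _; set b := lcomb u _.
have h1 : Re (inner (T w.1 a) b) <= e * rnorm a * rnorm b.
  rewrite (le_trans (Re_le_rnorm _))// (le_trans (CauchySchwarz_inner _ _))//.
  rewrite ler_wpM2r ?rnorm_ge0// (le_trans (bop_le _ _))// ler_wpM2r ?rnorm_ge0//.
have h2 := mulr_ge0 e0 (sqr_ge0 (rnorm a - rnorm b)).
move: h1 h2; move: (rnorm a) (rnorm b) (Re _) => p q t; nra.
Qed.

Lemma l2norm_sqr v : l2norm v ^+ 2 = vsq v.
Proof. by rewrite sqr_sqrtr// sumr_ge0// => i _; exact: sqr_ge0. Qed.

Lemma vsq_ge0 v : 0 <= vsq v.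
Proof. by rewrite -l2norm_sqr sqr_ge0. Qed.

Lemma kernel_mx_opnorm T (e : R) : 0 <= e -> (forall x, rnorm (T x) <= e) ->
  mx_opnorm (kernel_mx T) <= e.
Proof.
move=> e0 Te; apply: ge_sup.
  exists (l2norm (kernel_mx T *m 0)), 0 => //=.
  rewrite -(@ler_pXn2r _ 2) ?nnegrE ?sqrtr_ge0// l2norm_sqr /vsq expr1n.
  by rewrite big1 ?ler01// => i _; rewrite mxE rnorm0 expr0n.
move=> _ [v /= v1 <-]; set z := kernel_mx T *m v.
(* Tested against u = t z. For e > 0 the choice t = 1 / e yields |z|^2 <= e^2 |v|^2; for e = 0 the
   choice t = 1 forces z = 0. *)
have zb (t : R) : 2 * t * vsq z <= e * (vsq v + t ^+ 2 * vsq z).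
  have := kernel_mx_bound v (t%:C *: z) e0 Te.
  have -> : vsq (t%:C *: z) = t ^+ 2 * vsq z.
    rewrite /vsq mulr_sumr; apply: eq_bigr => i _; rewrite mxE rnormM exprMn.
    by congr (_ * _); rewrite -[rnorm _ ^+ 2]ReC -mulJ_rnorm conj_real -rmorphM ReC expr2.
  congr (_ <= _); rewrite -mulmxA -/z mxE -mulrA; congr (2 * _).
  rewrite -[RHS]ReC rmorphM rmorph_sum mulr_sumr; congr (Re _); apply: eq_bigr => i _.
  by rewrite !mxE cconjM conj_real -mulrA mulJ_rnorm.
rewrite -(@ler_pXn2r _ 2) ?nnegrE ?sqrtr_ge0// l2norm_sqr.
have v1' : vsq v <= 1 by rewrite -l2norm_sqr expr_le1 ?sqrtr_ge0.
have [e00|en0] := eqVneq e 0.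
  by have := zb 1; rewrite e00; have := vsq_ge0 z; nra.
have ep : 0 < e by rewrite lt_neqAle eq_sym en0.
have : e * (2 * e^-1 * vsq z) <= e * (e * (vsq v + e^-1 ^+ 2 * vsq z)).
  by rewrite ler_pM2l.
have -> : e * (2 * e^-1 * vsq z) = 2 * vsq z by field; rewrite gt_eqF.
have -> : e * (e * (vsq v + e^-1 ^+ 2 * vsq z)) = e ^+ 2 * vsq v + vsq z.
  by field; rewrite gt_eqF.
have : e ^+ 2 * vsq v <= e ^+ 2 by rewrite ler_piMr// sqr_ge0.
lra.
Qed.

Variable W : X -> bop H.
Hypothesis W_iso : forall x, cmul (star (W x)) (W x) = cone.

Definition twist (b : bop H) : X -> bop H := fun x => conjugate (W x) b.

Lemma fam_bounded_twist b : fam_bounded (twist b).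
Proof. by exists (rnorm b) => x; exact: rnorm_conjugate. Qed.

Definition ucp_twist (b : bop H) : 'M[R[i]]_n := kernel_mx (twist b).

Lemma twistP k b b' : twist (k *: b + b') = fun x => k *: twist b x + twist b' x.
Proof. by apply/funext => x; exact: conjugateP. Qed.

Lemma twist_sum (J : finType) (F : J -> bop H) (x : X) (y : H) :
  twist (\sum_l F l) x y = \sum_l bop_star (W x) (F l (W x y)).
Proof.
rewrite [LHS](_ : _ = bop_star (W x) ((\sum_l F l) (W x y)))//.
by rewrite bop_sum bop_sumr.
Qed.

Lemma ucp_twist_psd k (Y : 'I_k -> 'I_k -> bop H) :
  block_psd (fun i j => ucp_twist (\sum_(l < k) cmul (star (Y l i)) (Y l j))).
Proof.
move=> v.
pose h p q : Omega -> R[i] :=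
  sform (twist (\sum_(l < k) cmul (star (Y l p)) (Y l q))) (v q) (v p).
have qh p q : quad_bounded (h p q) by apply/quad_bounded_sform/fam_bounded_twist.
have -> : \sum_(i < k) \sum_(j < k) ((map_mx Num.conj (v i))^T *m
    ucp_twist (\sum_(l < k) cmul (star (Y l i)) (Y l j)) *m v j) ord0 ord0 =
    I (fun w => \sum_p \sum_q h p q w).
  rewrite integral_sum => [|p]; last exact: quad_bounded_sum.
  apply: eq_bigr => p _; rewrite integral_sum//; apply: eq_bigr => q _.
  by rewrite integral_sform//; exact: fam_bounded_twist.
apply: I_ge0 => [|w]; first by apply: quad_bounded_sum => p; exact: quad_bounded_sum.
(* In these vectors the integrand is the sum over l of |sum_q Y_lq eta_q|^2, hence nonnegative at
   every point. *)
pose eta p := W w.1 (lcomb (v p) w.2).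
have hE p q : h p q w = \sum_l inner (Y l q (eta q)) (Y l p (eta p)).
  rewrite /h /sform twist_sum inner_suml; apply: eq_bigr => l _.
  by rewrite !bop_starE'.
have -> : \sum_p \sum_q h p q w =
    \sum_l inner (\sum_q Y l q (eta q)) (\sum_p Y l p (eta p)).
  under [RHS]eq_bigr do rewrite inner_sumr.
  rewrite [RHS]exchange_big/=; apply: eq_bigr => p _.
  under [RHS]eq_bigr do rewrite inner_suml.
  by rewrite [RHS]exchange_big/=; apply: eq_bigr => q _; rewrite hE.
by apply: sumr_ge0 => l _; rewrite inner_rnorm ler0c sqr_ge0.
Qed.

Lemma ucp_twist_ucp (B' : set (bop H)) : ucp_on B' n ucp_twist.
Proof.
split => [k b b' _ _||k Y _]; last exact: ucp_twist_psd.
  by rewrite /ucp_twist twistP kernel_mxP//; exact: fam_bounded_twist.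
have -> : ucp_twist cone = kernel_mx (cone : A).
  by congr kernel_mx; apply/funext => x; rewrite /twist /conjugate cmul1l W_iso.
by case: ucp => _ <- _; rewrite kernel_mx_phi//; case: subB.
Qed.

Lemma ucp_twist_close (a : A) (b : bop H) (e : R) : B a -> 0 <= e ->
  (forall x, rnorm (twist b x - a x) <= e) -> mx_opnorm (ucp_twist b - phi a) <= e.
Proof.
move=> Ba e0 ba.
have -> : ucp_twist b - phi a = kernel_mx (fun x => (-1) *: a x + twist b x).
  rewrite kernel_mxP; [|exact: fam_bounded_cbfun|exact: fam_bounded_twist].
  by rewrite kernel_mx_phi// scaleN1r addrC.
by apply: kernel_mx_opnorm => // x; rewrite scaleN1r addrC.
Qed.

End integral.

Theorem ucp_perturb (W : X -> bop H) : (forall x, cmul (star (W x)) (W x) = cone) ->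
  exists psi : bop H -> 'M[R[i]]_n,
    (forall B' : set (bop H), ucp_on B' n psi) /\
    forall a b (e : R), B a -> 0 <= e ->
      (forall x, rnorm (conjugate (W x) b - a x) <= e) ->
      mx_opnorm (psi b - phi a) <= e.
Proof.
move=> W_iso; have [I [IP I_ge0 I_Re_ge0 I_phi]] := ucp_integral subB ucp.
exists (ucp_twist I W); split; first exact: ucp_twist_ucp.
by move=> a b e; exact: ucp_twist_close.
Qed.

End ucp_perturb.

(** * The torus and words in the columns of Q *)

Lemma rnorm_sqr_ReIm (R : realType) (z : R[i]) :
  rnorm z ^+ 2 = complex.Re z ^+ 2 + complex.Im z ^+ 2.
Proof. by rewrite -[LHS]ReC -mulJ_rnorm; case: z => a b /=; ring. Qed.

Lemma rnorm_le_ReIm (R : realType) (z : R[i]) :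
  rnorm z <= `|complex.Re z| + `|complex.Im z|.
Proof.
rewrite -(@ler_pXn2r _ 2) ?nnegrE ?addr_ge0 ?rnorm_ge0//.
rewrite rnorm_sqr_ReIm sqrrD !real_normK ?num_real//.
by rewrite addrAC lerDl mulrn_wge0// mulr_ge0.
Qed.

Section torus_words.
Variables (R : realType) (d : nat).
Implicit Types (x y z : 'rV[R[i]^o]_d).

Lemma max_dist_le x y (e : R) : 0 <= e ->
  (forall i, rnorm ((x ord0 i : R[i]) - y ord0 i) <= e) -> max_dist x y <= e.
Proof. by move=> e0 xy; apply: bigmax_le => // i _; exact: xy. Qed.

Lemma le_max_dist x y i : rnorm ((x ord0 i : R[i]) - y ord0 i) <= max_dist x y.
Proof. exact: (le_bigmax _ (fun i => rnorm ((x ord0 i : R[i]) - y ord0 i)) i). Qed.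

Lemma max_dist_ge0 x y : 0 <= max_dist x y.
Proof. exact: bigmax_ge_id. Qed.

Lemma max_distxx x : max_dist x x = 0.
Proof.
apply/le_anti; rewrite max_dist_ge0 andbT; apply: max_dist_le => // i.
by rewrite subrr rnorm0.
Qed.

Lemma max_dist_triangle x y z : max_dist x z <= max_dist x y + max_dist y z.
Proof.
apply: max_dist_le => [|i]; first by rewrite addr_ge0 ?max_dist_ge0.
by rewrite -(subrKA (y ord0 i : R[i])) (le_trans (ler_rnormD _ _))// lerD ?le_max_dist.
Qed.

Lemma near_max_dist x (e : R) : 0 < e -> \forall y \near x, max_dist y x < e.
Proof.
move=> e0; have e20 : 0 < e / 2 by rewrite divr_gt0.
have ci i : nbhs x [set y : 'rV[R[i]^o]_d | rnorm ((y ord0 i : R[i]) - x ord0 i) <= e / 2].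
  have c3 : continuous (fun y : 'rV[R[i]^o]_d => y ord0 i) by exact: (@coord_continuous R[i]).
  by move/(_ x)/(@rnorm_continuousP _ _ _ _ x)/(_ _ e20) : c3.
have : nbhs x [set y : 'rV[R[i]^o]_d |
    forall i, rnorm ((y ord0 i : R[i]) - x ord0 i) <= e / 2].
  exact: (@filter_forall _ _ (fun i (y : 'rV[R[i]^o]_d) => _ : Prop) (nbhs x) _ ci).
apply: filterS => y yx; apply: (@le_lt_trans _ _ (e / 2)).
  by apply: max_dist_le => //; exact: ltW.
by rewrite ltr_pdivrMr// ltr_pMr// ltr1n.
Qed.

(** A closed subset of the image of the square [-1, 1]^2 under (a, b) |-> a + i b. *)
Lemma compact_circle : compact [set z : R[i]^o | `|z| = 1].
Proof.
pose f (p : R * R) : R[i]^o := (p.1 +i* p.2)%C.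
have cf : continuous f.
  move=> p; apply/rnorm_continuousP => e e0.
  have e20 : 0 < e / 2 by rewrite divr_gt0.
  have c1 : nbhs p [set q : R * R | `|q.1 - p.1| <= e / 2].
    have : fst q @[q --> p] --> p.1 by exact: cvg_fst.
    by move=> /cvgrPdist_le/(_ _ e20); apply: filterS => q; rewrite distrC.
  have c2 : nbhs p [set q : R * R | `|q.2 - p.2| <= e / 2].
    have : snd q @[q --> p] --> p.2 by exact: cvg_snd.
    by move=> /cvgrPdist_le/(_ _ e20); apply: filterS => q; rewrite distrC.
  apply: (@filterS _ (nbhs p) _ _ _ _ (filterI c1 c2)) => q [/= h1 h2].
  rewrite (le_trans (rnorm_le_ReIm _))// [e]splitr; exact: lerD.
apply: (@subclosed_compact _ _ (f @` (`[-1, 1]%classic `*` `[-1, 1]%classic))).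
- apply: (@preimage_closed R[i]^o R[i]^o Num.norm [set 1]).
    by move=> z _; exact: (@norm_continuous _ R[i]^o).
  exact: (accessible_closed_set1 (hausdorff_accessible (@norm_hausdorff _ R[i]^o))).
- apply: continuous_compact; first exact: continuous_subspaceT.
  by apply: compact_setX; exact: segment_compact.
- move=> z /= z1; have rz : rnorm (z : R[i]) = 1 by rewrite /rnorm z1.
  exists (complex.Re z, complex.Im z); last by rewrite /f; case: (z).
  rewrite /= !in_itv/= -!ler_norml -rz.
  by split; [exact: abs_Re_le_rnorm|exact: abs_Im_le_rnorm].
Qed.

Lemma compact_torus : compact (torus R d).
Proof. exact: (rV_compact (fun=> compact_circle)). Qed.

Variable Q : 'M[R[i]]_d.
Hypothesis Q1 : forall i j, `|Q i j| = 1.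

Lemma letter_torus c i : `|letter Q c ord0 i| = 1.
Proof. by rewrite /letter; case: c.2; rewrite !mxE ?normfV Q1 ?invr1. Qed.

Lemma word_torus w : torus R d (word_value Q w).
Proof.
elim: w => [|c w IH] i /=; first by rewrite mxE normr1.
by rewrite mxE normrM letter_torus IH mulr1.
Qed.

Lemma word_cat w w' : word_value Q (w ++ w') = torus_mul (word_value Q w) (word_value Q w').
Proof.
elim: w => [|c w IH] /=; apply/rowP => i.
  by rewrite !mxE mul1r.
by rewrite IH !mxE mulrA.
Qed.

(** The word is not reversed because the torus is commutative. *)
Lemma word_inv w : word_value Q [seq (c.1, ~~ c.2) | c <- w] = torus_inv (word_value Q w).
Proof.
elim: w => [|c w IH] /=; apply/rowP => i; first by rewrite !mxE invr1.
rewrite IH !mxE invfM; congr (_ * _).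
by rewrite /letter/=; case: c.2; rewrite !mxE ?invrK.
Qed.

Lemma subgroup_word x : subgroup_SQ Q x -> exists w, x = word_value Q w.
Proof.
have -> : (exists w, x = word_value Q w) = [set x | exists w, x = word_value Q w] x by [].
move: x; apply: (@smallest_sub _ (@torus_subgroup R d) (range (column Q))).
  split.
  - by move=> _ [w ->]; exact: word_torus.
  - by exists [::].
  - by move=> _ _ [w ->] [w' ->]; exists (w ++ w'); rewrite word_cat.
  - by move=> _ [w ->]; exists [seq (c.1, ~~ c.2) | c <- w]; rewrite word_inv.
move=> _ [l _ <-]; exists [:: (l, false)] => /=; apply/rowP => i.
by rewrite !mxE mulr1.
Qed.

Lemma torus_one_torus : torus R d (torus_one R d).
Proof. by move=> i; rewrite mxE normr1. Qed.

Lemma hausdorff_lt (S : set 'rV[R[i]^o]_d) (e : R) :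
  (hausdorff (@max_dist R d) (torus R d) S < e%:E)%E ->
  forall x, torus R d x -> exists2 y, S y & max_dist x y < e.
Proof.
rewrite gt_max => /andP[h _] x Tx.
have /ereal_inf_lt[_ [y Sy <-]] : (ereal_inf [set (max_dist x b)%:E | b in S] < e%:E)%E.
  by apply: le_lt_trans h; apply: ereal_sup_ubound; exists x.
by rewrite lte_fin => xy; exists y.
Qed.

Lemma hausdorff_le (S : set 'rV[R[i]^o]_d) (e : R) : 0 <= e -> S `<=` torus R d ->
  (forall x, torus R d x -> exists2 y, S y & max_dist x y <= e) ->
  (hausdorff (@max_dist R d) (torus R d) S <= e%:E)%E.
Proof.
move=> e0 ST h; rewrite ge_max; apply/andP; split; apply: ge_ereal_sup => _ [x Tx <-].
  apply: ge_ereal_inf; have [y Sy xy] := h x Tx.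
  by exists (max_dist x y)%:E; [exists y|rewrite lee_fin].
apply: ge_ereal_inf; exists (max_dist x x)%:E; first by exists x => //; exact: ST.
by rewrite lee_fin max_distxx.
Qed.

(** A word within eta1 < eta of x is within eta1 + e < eta of the whole e-ball around x. Compactness
    of the torus turns the lengths of these words into one common bound N. *)
Lemma words_dense (eta : R) : (eta_of Q < eta%:E)%E ->
  exists N, (hausdorff (@max_dist R d) (torus R d) (words_SQ Q N) < eta%:E)%E.
Proof.
move=> h.
have [eta1 h1 h2] : exists2 eta1 : R, (eta_of Q < eta1%:E)%E & eta1 < eta.
  case: (eta_of Q) h => [r|//|_].
    rewrite lte_fin => re; exists ((r + eta) / 2); rewrite ?lte_fin; lra.
  by exists (eta - 1); [rewrite ltNyr|lra].
have eta10 : 0 < eta1.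
  have [y _ /(le_lt_trans (max_dist_ge0 _ _))] := hausdorff_lt h1 torus_one_torus.
  by [].
pose e := (eta - eta1) / 2.
have e0 : 0 < e by rewrite /e; lra.
have /compact_near_coveringP cT := compact_torus.
have [N _ HN] : \forall N \near \oo, torus R d `<=`
    (fun x => exists2 w, (size w <= N)%N & max_dist x (word_value Q w) < eta1 + e).
  apply: cT => x Tx.
  have [y /subgroup_word[w ->] xw] := hausdorff_lt h1 Tx.
  exists ([set x' | max_dist x' x < e], [set N | (size w <= N)%N]) => /=.
    by split; [exact: near_max_dist|exact: nbhs_infty_ge].
  move=> [x' N] /= [x'x wN]; exists w => //.
  by rewrite (le_lt_trans (max_dist_triangle _ x _))// addrC ltrD.
exists N; apply: (@le_lt_trans _ _ (eta1 + e)%:E); last by rewrite lte_fin /e; lra.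
apply: hausdorff_le => [||x /(HN N (leqnn N))[w wN xw]].
- lra.
- by move=> _ [w _ <-]; exact: word_torus.
- by exists (word_value Q w); [exists w|exact: ltW].
Qed.

Theorem N_of_word (eta : R) x : (eta_of Q < eta%:E)%E -> torus R d x ->
  exists2 w, (size w <= N_of Q eta)%N & max_dist x (word_value Q w) < eta.
Proof.
move=> h Tx; rewrite /N_of.
(* [xget] returns its default 0 on an empty set, so a least good length must be shown to exist. *)
set P := mkset _; have [/= + _] : P (xget 0%N P).
  apply: xgetPex.
  have [N0 HN0] := words_dense h.
  pose good N := `[< (hausdorff (@max_dist R d) (torus R d) (words_SQ Q N) < eta%:E)%E >].
  have exg : exists N, good N by exists N0; apply/asboolP.
  exists (ex_minn exg); case: ex_minnP => N /asboolP gN minN; split => // M gM.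
  by apply: minN; apply/asboolP.
move=> /hausdorff_lt/(_ _ Tx)[_ [w wN <-] xw].
by exists w.
Qed.

End torus_words.

(** * Words in the unitaries *)

Section unitary_words.
Variables (R : realType) (A : cstarAlgType R).
Implicit Types (a b u v : A).

Variables (d : nat) (Theta : 'M[R]_d) (delta : R) (U : 'I_d -> A).
Hypothesis hU : forall i, unitary (U i).
Hypothesis hcomm : forall k l : 'I_d,
  rnorm (cmul (U l) (U k) - expi (Theta k l) *: cmul (U k) (U l)) <= delta.
Local Notation Q := (Q_of Theta).

Lemma norm_expi (t : R) : `|expi t| = 1.
Proof.
rewrite -rnormE; congr (_%:C); apply/eqP.
rewrite -(@eqrXn2 _ 2) ?rnorm_ge0 ?ler01// expr1n rnorm_sqr_ReIm/=.
by rewrite cos2Dsin2.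
Qed.

Lemma norm_Q_of i j : `|Q i j| = 1.
Proof. by rewrite mxE norm_expi. Qed.

(** The choice is opposite to that in [letter]: U_l U_i is close to Q_il U_i U_l, so it is
    conjugation by the adjoint of U_l, a |-> U_l a U_l^*, that multiplies U_i by the entry i of the
    column l. *)
Definition letter_unitary (c : 'I_d * bool) : A := if c.2 then U c.1 else star (U c.1).

(** Letters are multiplied on the right, so that by [conjugateM] the head of the word acts as the
    outermost conjugation. *)
Definition word_unitary (w : seq ('I_d * bool)) : A :=
  foldr (fun c v => cmul v (letter_unitary c)) cone w.

Lemma letter_unitary_isometry c : cmul (star (letter_unitary c)) (letter_unitary c) = cone.
Proof.
by have [u1 u2] := hU c.1; rewrite /letter_unitary; case: c.2; rewrite ?starK.
Qed.

Lemma word_unitary_isometry w : cmul (star (word_unitary w)) (word_unitary w) = cone.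
Proof.
elim: w => [|c w IH] /=; first by rewrite star_cone cmul1l.
by rewrite starM -cmulA [X in cmul _ X]cmulA IH cmul1l letter_unitary_isometry.
Qed.

Lemma letter_unitary_close c i :
  rnorm (conjugate (letter_unitary c) (U i) - letter Q c ord0 i *: U i) <= delta.
Proof.
case: c => l b; have [u1 u2] := hU l; have ru := rnorm_isometry u1.
have h := hcomm i l; have d0 := le_trans (rnorm_ge0 _) h.
rewrite /letter_unitary /letter /conjugate /=; case: b; rewrite /= !mxE; last first.
  (* With q = Q_il, the difference U_l U_i U_l^* - q U_i equals (U_l U_i - q U_i U_l) U_l^*. *)
  rewrite starK -[U i in X in _ - X]cmul1r -u2 [X in _ *: X]cmulA -cmulZl cmulA -cmulNl -cmulDl.
  rewrite (le_trans (rnorm_cmul _ _))// rnorm_star.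
  by rewrite (le_trans (ler_wpM2r (rnorm_ge0 _) h))// ler_piMr.
set e := expi _; have e1 : `|e| = 1 by exact: norm_expi.
have e0 : e != 0 by rewrite -normr_eq0 e1 oner_eq0.
have -> : cmul (star (U l)) (cmul (U i) (U l)) - e^-1 *: U i =
    (- e^-1) *: cmul (star (U l)) (cmul (U l) (U i) - e *: cmul (U i) (U l)).
  rewrite cmulDr cmulNr cmulZr [cmul _ (cmul (U l) (U i))]cmulA u1 cmul1l scalerDr scalerN.
  by rewrite !scaleNr opprK scalerA mulVf// scale1r addrC.
rewrite rnormZ rnormN rnormV {1}/rnorm e1 invr1 mul1r.
rewrite (le_trans (rnorm_cmul _ _))// rnorm_star.
by rewrite (le_trans (ler_wpM2l (rnorm_ge0 _) h))// ler_piMl.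
Qed.

(** Errors add up, one delta per letter: conjugation is contractive, and the scalar accumulated so
    far has modulus 1. *)
Lemma word_unitary_close w i :
  rnorm (conjugate (word_unitary w) (U i) - word_value Q w ord0 i *: U i) <=
  (size w)%:R * delta.
Proof.
elim: w => [|c w IH] /=.
  by rewrite mxE scale1r /conjugate star_cone cmul1l cmul1r subrr rnorm0 mul0r.
set v : R[i] := word_value Q w ord0 i.
have v1 : rnorm v = 1 by rewrite /rnorm (word_torus norm_Q_of w i).
rewrite mxE -/v conjugateM.
have -> : conjugate (letter_unitary c) (conjugate (word_unitary w) (U i)) -
    (letter Q c ord0 i * v) *: U i =
    conjugate (letter_unitary c) (conjugate (word_unitary w) (U i) - v *: U i) +
    v *: (conjugate (letter_unitary c) (U i) - letter Q c ord0 i *: U i).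
  have -> : conjugate (word_unitary w) (U i) - v *: U i =
      (- v) *: U i + conjugate (word_unitary w) (U i) by rewrite scaleNr addrC.
  by rewrite conjugateP scalerBr scalerA [v * _]mulrC scaleNr [- _ + _]addrC subrKA.
rewrite (le_trans (ler_rnormD _ _))// rnormZ v1 mul1r -[_.+1%:R]natr1 mulrDl mul1r.
apply: lerD; last exact: letter_unitary_close.
exact: le_trans (rnorm_conjugate _ (letter_unitary_isometry c)) IH.
Qed.

End unitary_words.

(** * Generated C*-algebras and evaluation at the unit of the torus *)

Lemma cstar_gen_subalgebra (R : realType) (A : cstarAlgType R) d (a : 'I_d -> A) :
  cstar_subalgebra (cstar_gen a).
Proof.
split.
- by apply: closed_bigI => B [[clB _ _ _ _] _].
- by move=> B [[_ B1 _ _ _] _].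
- by move=> k x y Bx By B sB; have [[_ _ BP _ _] _] := sB; apply: BP; [exact: Bx|exact: By].
- by move=> x y Bx By B sB; have [[_ _ _ BM _] _] := sB; apply: BM; [exact: Bx|exact: By].
- by move=> x Bx B sB; have [[_ _ _ _ Bs] _] := sB; apply: Bs; exact: Bx.
Qed.

Lemma cstar_gen_in (R : realType) (A : cstarAlgType R) d (a : 'I_d -> A) i :
  cstar_gen a (a i).
Proof. by move=> B [_]; apply; exists i. Qed.

Lemma l2norm0 (R : realType) n : l2norm (0 : 'cV[R[i]]_n) = 0.
Proof. by rewrite /l2norm big1 ?sqrtr0// => i _; rewrite mxE rnorm0 expr0n. Qed.

Lemma mx_opnorm0_le (R : realType) n : mx_opnorm (0 : 'M[R[i]]_n) <= 0.
Proof.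
apply: ge_sup.
  by exists (l2norm ((0 : 'M[R[i]]_n) *m 0)), 0 => //=; rewrite l2norm0.
by move=> _ [v _ <-]; rewrite mul0mx l2norm0.
Qed.

Section matrix_range_tensor.
Variables (R : realType) (H : hilbertType R) (d : nat) (U : 'I_d -> bop H).
Local Notation A := (cbfun (torus R d) (bop H)).

Lemma cbfun_eval_continuous (X : topologicalType) (x : X) :
  continuous (fun f : cbfun X (bop H) => f x).
Proof.
move=> f; apply/rnorm_continuousP => e e0.
have /rnorm_continuousP/(_ _ e0) : {for f, continuous (fun g : cbfun X (bop H) => g)}.
  exact: cvg_id.
by apply: filterS => g; apply: le_trans; rewrite -cbfunBE; exact: cbfun_le.
Qed.

(** A map that is ucp on C*(U) can be composed with evaluation only if evaluation lands in C*(U).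
    The functions whose value at x lies there form a C*-subalgebra, closed because evaluation is
    continuous, and it contains the generators. *)
Lemma cstar_gen_eval (x : torus R d) (f : A) :
  (forall i, \val x ord0 i = 1) -> cstar_gen (tensor_z U) f -> cstar_gen U (f x).
Proof.
move=> x1; move: f; apply: (@smallest_sub _ (@cstar_subalgebra R A) (range (tensor_z U))
  [set f : A | cstar_gen U (f x)]).
  have [clU U1 UP UM Us] := cstar_gen_subalgebra U.
  split => /=.
  - apply: (@preimage_closed _ _ (fun f : A => f x) (cstar_gen U)) => // f _.
    exact: cbfun_eval_continuous.
  - exact: U1.
  - by move=> k f g; exact: UP.
  - by move=> f g; exact: UM.
  - by move=> f; exact: Us.
move=> _ [i _ <-] /=; rewrite x1 scale1r; exact: cstar_gen_in.
Qed.

Lemma matrix_range_tensor n : matrix_range n U `<=` matrix_range n (tensor_z U).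
Proof.
move=> _ [phi [lin u1 psd] <-].
pose x : torus R d := exist _ (torus_one R d) (mem_set (@torus_one_torus R d)).
have x1 i : \val x ord0 i = 1 by rewrite mxE.
exists (fun f : A => phi (f x)); last first.
  by apply/funext => i /=; rewrite x1 scale1r.
split.
- by move=> k f g Bf Bg; apply: lin; exact: cstar_gen_eval.
- exact: u1.
- move=> k Y BY v.
  have := psd k (fun i j => Y i j x) (fun i j => cstar_gen_eval x1 (BY i j)) v.
  congr (0 <= _); apply: eq_bigr => i _; apply: eq_bigr => j _.
  by rewrite cbfun_sum.
Qed.

End matrix_range_tensor.

Theorem proposition4p6 (R : realType) (d : nat) (Theta : 'M[R]_d)
    (hTheta : Theta^T = - Theta)
    (eta : R) (heta : (eta_of (Q_of Theta) < eta%:E)%E)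
    (H : hilbertType R) (hH : separable_space H)
    (U : 'I_d -> bop H) (hU : forall i, unitary (U i))
    (delta : R) (hdelta : 0 < delta)
    (hcomm : almost_commuting Theta delta U) :
  almost_gauge_invariant ((N_of (Q_of Theta) eta)%:R * delta + eta) U.
Proof.
set Q := Q_of Theta; set N := N_of Q eta; set e := _ + eta.
have Q1 : forall i j, `|Q i j| = 1 by exact: norm_Q_of.
have words (x : torus R d) : exists2 w, (size w <= N)%N & max_dist (\val x) (word_value Q w) < eta.
  by apply: N_of_word => //; exact: set_mem (valP x).
(* Positivity of [eta] comes from its exceeding a distance between points. *)
have eta0 : 0 < eta.
  have [w _] := N_of_word Q1 heta (@torus_one_torus R d).
  exact: le_lt_trans (max_dist_ge0 _ _).
have e0 : 0 <= e by apply: addr_ge0; [apply: mulr_ge0 => //|]; exact: ltW.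
pose w x := s2val (cid2 (words x)).
pose W x := word_unitary U (w x).
have W_iso x : cmul (star (W x)) (W x) = cone by exact: word_unitary_isometry.
have W_close i x : rnorm (conjugate (W x) (U i) - tensor_z U i x) <= e.
  rewrite /W /w; case: cid2 => v /= vN xv.
  (* The detour through v_i U_i, with v the value of the chosen word: the length of the word costs N
     delta, replacing v by x costs eta. *)
  rewrite -(subrKA (word_value Q v ord0 i *: U i)) (le_trans (ler_rnormD _ _))// lerD//.
    apply: le_trans (word_unitary_close hU hcomm v i) _.
    by rewrite ler_wpM2r ?ler_nat// ltW.
  rewrite -scalerBl rnormZ.
  have [u1 _] := hU i; have ru := rnorm_isometry u1.
  have h : rnorm ((word_value Q v ord0 i : R[i]) - \val x ord0 i) <= eta.
    by rewrite rdistC (le_trans (le_max_dist _ _ _))// ltW.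
  by rewrite (le_trans (ler_wpM2r (rnorm_ge0 _) h))// ler_piMr// ltW.
apply: ge_ereal_sup => _ [n _ <-].
rewrite ge_max; apply/andP; split; apply: ge_ereal_sup => _ [a Ua <-]; apply: ge_ereal_inf.
  (* By the inclusion of matrix ranges, [a] approximates itself. *)
  exists (tuple_dist (fun X Y : 'M[R[i]]_n => mx_opnorm (X - Y)) a a)%:E.
    by exists a => //; exact: matrix_range_tensor.
  rewrite lee_fin; apply: bigmax_le => // i _; rewrite subrr.
  exact: le_trans (mx_opnorm0_le _ _) e0.
case: Ua => phi ucp <-.
have [psi [psi_ucp psi_close]] := ucp_perturb (cstar_gen_subalgebra _) ucp W_iso.
exists (tuple_dist (fun X Y : 'M[R[i]]_n => mx_opnorm (X - Y))
  (fun i => psi (U i)) (fun i => phi (tensor_z U i)))%:E.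
  by exists (fun i => psi (U i)) => //; exists psi.
rewrite lee_fin; apply: bigmax_le => // i _.
by apply: psi_close => //; exact: cstar_gen_in.
Qed.
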